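(* Let $\Lambda$ be an artin algebra and let $\mathcal{C}$ be a functorially finite (full, additive) subcategory of $\mathrm{mod}\,\Lambda$, closed under direct summands and isomorphisms, which contains $\Lambda$ or $D\Lambda$. Then $\mathcal{C}$ is of finite representation type if and only if the following two conditions hold. (i) For any $\mathcal{C}$-module $F$, any $X\in\mathcal{C}$ and any $0\neq x\in F(X)$, there is a morphism $f:X\to X'$ in $\mathcal{C}$ such that $F(f)(x)$ is a strongly minimal element in $F(X')$. (ii) Any family of monomorphisms between indecomposable objects in $\mathcal{C}$ is noetherian.
   Context: $\Lambda$ is an artin $R$-algebra over a commutative artinian ring $R$; $\mathrm{mod}\,\Lambda$ is the category of finitely generated left $\Lambda$-modules; $D=\mathrm{Hom}_R(-,I)$ with $I$ the injective envelope of $R/J_R$, $J_R$ the Jacobson radical of $R$. Monomorphisms are understood as monomorphisms of $\Lambda$-modules. A left $\mathcal{C}$-approximation of $X\in\mathrm{mod}\,\Lambda$ is a morphism $\alpha:X\to C$ with $C\in\mathcal{C}$ such that every morphism $X\to C'$ with $C'\in\mathcal{C}$ factors through $\alpha$; right $\mathcal{C}$-approximations are dual. $\mathcal{C}$ is functorially finite if every $X\in\mathrm{mod}\,\Lambda$ has both a left and a right $\mathcal{C}$-approximation. $\mathcal{C}$ is of finite representation type if it has finitely many isomorphism classes of indecomposable objects. A $\mathcal{C}$-module is an additive covariant functor from $\mathcal{C}$ to abelian groups. For a $\mathcal{C}$-module $F$ and $X\in\mathcal{C}$, an element $x\in F(X)$ is strongly minimal if $x\neq0$ and $F(f)(x)=0$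 for every morphism $f:X\to X'$ in $\mathcal{C}$ which is not a monomorphism. A family $\{f_j\}_{j\in J}$ of morphisms in $\mathcal{C}$ is noetherian if for any infinite chain $C_0\xrightarrow{f_{j_1}}C_1\xrightarrow{f_{j_2}}C_2\to\cdots$ of morphisms in the family with $f_{j_i}\cdots f_{j_2}f_{j_1}\ne0$ for all $i$, there is $d\ge1$ such that $f_{j_k}$ is an isomorphism for all $k\ge d$. *)

(* Defs.v *)
From HB Require Import structures.
From mathcomp Require Import all_boot all_algebra.
From mathcomp Require Import boolp classical_sets.
Set Implicit Arguments.
Unset Strict Implicit.
Unset Printing Implicit Defensive.
Import GRing.Theory.
Local Open Scope ring_scope.
Local Open Scope classical_set_scope.

Section Modules.
Variable A : pzRingType.
Implicit Types M N X Y Z : lmodType A.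

Definition is_submodule M (S : set M) : Prop :=
  S 0 /\ forall (a : A) (x y : M), S x -> S y -> S (a *: x + y).

Definition finitely_generated M : Prop :=
  exists (n : nat) (v : 'I_n -> M),
    forall x : M, exists c : 'I_n -> A, x = \sum_(i < n) c i *: v i.

Definition isomorphic M N : Prop := exists f : {linear M -> N}, bijective f.

Definition is_zero M : Prop := forall x : M, x = 0.

Definition indecomposable M : Prop :=
  ~ is_zero M /\
  forall Y Z, isomorphic M (Y * Z)%type -> is_zero Y \/ is_zero Z.

Definition injective_module (I : lmodType A) : Prop :=
  forall M N (i : {linear M -> N}) (f : {linear M -> I}),
    injective i -> exists g : {linear N -> I}, forall x : M, g (i x) = f x.

Definition injective_envelope M (I : lmodType A) (e : {linear M -> I}) : Prop :=
  [/\ injective_module I,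
      injective e
    & forall S : set I, is_submodule S ->
        S `&` range e `<=` [set 0] -> S `<=` [set 0] ].

End Modules.

Section CommutativeRing.
Variable R : comNzRingType.

Definition is_ideal (J : set R) : Prop := @is_submodule R R^o J.

Definition artinian_ring : Prop :=
  forall J : nat -> set R,
    (forall n, is_ideal (J n)) -> (forall n, J n.+1 `<=` J n) ->
    exists n, forall m, (n <= m)%N -> J m = J n.

Definition maximal_ideal (m : set R) : Prop :=
  [/\ is_ideal m,
      m <> setT
    & forall J : set R, is_ideal J -> m `<=` J -> J = m \/ J = setT ].

Definition jacobson_radical : set R :=
  [set r | forall m : set R, maximal_ideal m -> m r].

(* Q, together with p, is the quotient module R / J_R. *)
Definition quotient_by_radical (Q : lmodType R) (p : {linear R^o -> Q}) : Prop :=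
  range p = setT /\ forall r : R, p r = 0 <-> jacobson_radical r.

End CommutativeRing.

Definition artin_algebra (R : comNzRingType) (L : algType R) : Prop :=
  artinian_ring R /\ @finitely_generated R L.

Lemma linear_eqP (A : pzRingType) (M N : lmodType A) (f g : {linear M -> N}) :
  f =1 g -> f = g.
Proof.
move=> /funext; case: f g => [f [[f1] [f2]]] [g [[g1] [g2]]] /= fg.
case: g / fg g1 g2 => g1 g2.
by rewrite (Prop_irrelevance f1 g1) (Prop_irrelevance f2 g2).
Qed.

Section DualRegular.
Variables (R : comNzRingType) (L : algType R) (I : lmodType R).

(* Hom_R(L, I) as a left L-module, with (a phi)(x) = phi (x a), the action
   induced by the right L-module structure of L. *)
Definition dual_regular := {linear L -> I}.

HB.instance Definition _ := gen_eqMixin dual_regular.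
HB.instance Definition _ := gen_choiceMixin dual_regular.

Implicit Types f g h : dual_regular.

Definition dual_zero : dual_regular := \0.
Definition dual_opp f : dual_regular := \- f.
Definition dual_add f g : dual_regular := f \+ g.
Definition dual_scale (a : L) f : dual_regular := f \o (a \o* idfun).

Lemma dual_addA : associative dual_add.
Proof. by move=> f g h; apply: linear_eqP => x /=; rewrite addrA. Qed.
Lemma dual_addC : commutative dual_add.
Proof. by move=> f g; apply: linear_eqP => x /=; rewrite addrC. Qed.
Lemma dual_add0 : left_id dual_zero dual_add.
Proof. by move=> f; apply: linear_eqP => x /=; rewrite add0r. Qed.
Lemma dual_addN : left_inverse dual_zero dual_opp dual_add.
Proof. by move=> f; apply: linear_eqP => x /=; rewrite addNr. Qed.

HB.instance Definition _ :=
  GRing.isZmodule.Build dual_regular dual_addA dual_addC dual_add0 dual_addN.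

Lemma dual_scaleA (a b : L) f :
  dual_scale a (dual_scale b f) = dual_scale (a * b) f.
Proof. by apply: linear_eqP => x /=; rewrite mulrA. Qed.
Lemma dual_scale1 : left_id 1 dual_scale.
Proof. by move=> f; apply: linear_eqP => x /=; rewrite mulr1. Qed.
Lemma dual_scaleDr : right_distributive dual_scale +%R.
Proof. by move=> a f g; apply: linear_eqP. Qed.
Lemma dual_scaleDl f : {morph dual_scale^~ f : a b / a + b}.
Proof. by move=> a b; apply: linear_eqP => x /=; rewrite mulrDr linearD. Qed.

HB.instance Definition _ := GRing.Zmodule_isLmodule.Build L dual_regular
  dual_scaleA dual_scale1 dual_scaleDr dual_scaleDl.

End DualRegular.

(* A full subcategory of the category of left A-modules is given by the
   predicate C that selects its objects. *)
Section Subcategories.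
Variables (A : pzRingType) (C : lmodType A -> Prop).

Definition in_mod : Prop := forall X : lmodType A, C X -> finitely_generated X.

Definition iso_closed : Prop := forall X Y : lmodType A, C X -> isomorphic X Y -> C Y.

Definition additive_subcategory : Prop :=
  (forall Z : lmodType A, is_zero Z -> C Z) /\
  (forall X Y : lmodType A, C X -> C Y -> C (X * Y)%type).

Definition summand_closed : Prop :=
  forall X Y Z : lmodType A, C X -> isomorphic X (Y * Z)%type -> C Y.

Definition left_approximation (X Y : lmodType A) (u : {linear X -> Y}) : Prop :=
  C Y /\ forall Y', C Y' -> forall g : {linear X -> Y'},
    exists h : {linear Y -> Y'}, forall x, g x = h (u x).

Definition right_approximation (X Y : lmodType A) (u : {linear Y -> X}) : Prop :=
  C Y /\ forall Y', C Y' -> forall g : {linear Y' -> X},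
    exists h : {linear Y' -> Y}, forall y, g y = u (h y).

Definition functorially_finite : Prop :=
  forall X : lmodType A, finitely_generated X ->
    (exists (Y : lmodType A) (u : {linear X -> Y}), left_approximation u) /\
    (exists (Y : lmodType A) (u : {linear Y -> X}), right_approximation u).

Definition finite_representation_type : Prop :=
  exists (n : nat) (M : 'I_n -> lmodType A),
    forall X, C X -> indecomposable X -> exists i, isomorphic X (M i).

Record cobj := CObj { cobj_mod :> lmodType A; cobjP : C cobj_mod }.

Record cmodule := CModule {
  cm_obj :> cobj -> zmodType;
  cm_map : forall X Y : cobj, {linear X -> Y} -> {additive cm_obj X -> cm_obj Y};
  cm_map_id : forall (X : cobj) (x : cm_obj X),
    cm_map (idfun : {linear X -> X}) x = x;
  cm_map_comp : forall (X Y Z : cobj) (g : {linear Y -> Z}) (f : {linear X -> Y})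
    (x : cm_obj X), cm_map (g \o f : {linear X -> Z}) x = cm_map g (cm_map f x);
  cm_map_add : forall (X Y : cobj) (f g : {linear X -> Y}) (x : cm_obj X),
    cm_map (f \+ g : {linear X -> Y}) x = cm_map f x + cm_map g x }.

Definition strongly_minimal (F : cmodule) (X : cobj) (x : F X) : Prop :=
  x <> 0 /\
  forall (X' : cobj) (f : {linear X -> X'}), ~ injective f -> cm_map F f x = 0.

Record arrow := Arrow {
  arrow_src : cobj;
  arrow_tgt : cobj;
  arrow_map :> {linear arrow_src -> arrow_tgt} }.

Fixpoint chain_comp (X : nat -> cobj) (f : forall i, {linear X i -> X i.+1})
    (n : nat) : {linear X 0%N -> X n} :=
  if n is m.+1 then f m \o chain_comp f m else idfun.

(* The chain X 0 -> X 1 -> ... with maps f 0, f 1, ... runs through the family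
   phi along the index sequence j; packing a map with its endpoints makes
   "f i is the member of index j i" a plain equality. *)
Definition noetherian_family (J : Type) (phi : J -> arrow) : Prop :=
  forall (X : nat -> cobj) (f : forall i, {linear X i -> X i.+1}) (j : nat -> J),
    (forall i, phi (j i) = Arrow (f i)) ->
    (forall n, exists x, chain_comp f n.+1 x <> 0) ->
    exists d, forall k, (d <= k)%N -> bijective (f k).

End Subcategories.

(* D L belongs to C, where D = Hom_R(-, I) and I is the injective envelope of
   the quotient Q of R by its Jacobson radical.  Any choice of Q and I gives
   the same condition when C is closed under isomorphisms. *)
Definition contains_dual_regular (R : comNzRingType) (L : algType R)
    (C : lmodType L -> Prop) : Prop :=
  exists (Q I : lmodType R) (p : {linear R^o -> Q}) (e : {linear Q -> I}),
    [/\ quotient_by_radical p, injective_envelope e & C (dual_regular L I)].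

(* Main.v *)
(* Let Y0 be a left approximation of the regular module; Hom(Y0, -) does not vanish
   on any nonzero object of the subcategory.  The two conditions make every nonzero
   element of a functor reach an element killed by all maps that are not split
   monomorphisms: (i) gives a strongly minimal element, and as long as it is not killed
   by all non-split maps it can be moved along a proper monomorphism, which by (ii)
   happens finitely often.  Hence a subfunctor K of Hom(Y0, -) that is maximal among
   those for which "K is finitely generated and Hom(Y0, -)/K has finite support" fails
   lies below a subfunctor K' for which it holds, with K'/K simple.  Simple functors are
   finitely presented because left almost split maps exist, so it holds for K as well.
   This contradiction shows that Hom(Y0, -) has finite support.  Left almost split maps
   in the subcategory come, through left approximations, from those in mod L, which are
   pushouts obtained from a Matlis duality over R.
   Conversely, in finite type the lengths of indecomposables are bounded: chains of
   monomorphisms become stationary, and infinite chains of non-monomorphisms have a zero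
   composite (Harada-Sai). *)
Require Import Defs.
From HB Require Import structures.
From mathcomp Require Import all_boot all_algebra.
From mathcomp Require Import boolp classical_sets zify.
Set Implicit Arguments.
Unset Strict Implicit.
Unset Printing Implicit Defensive.
Import GRing.Theory.
Local Open Scope ring_scope.
Local Open Scope classical_set_scope.

(** * Submodules and quotients *)
Section Submodules.
Variable A : pzRingType.
Implicit Types M N P : lmodType A.

Definition lin_of M N (f : M -> N) (fl : linear f) : {linear M -> N} :=
  HB.pack f (GRing.isLinear.Build A M N *:%R f fl).

Definition ker M N (f : M -> N) : set M := [set x | f x = 0].

Lemma submod0 M (S : set M) : is_submodule S -> S 0.
Proof. by case. Qed.

Lemma submodD M (S : set M) x y : is_submodule S -> S x -> S y -> S (x + y).
Proof. by case=> _ H Sx Sy; rewrite -[x]scale1r; apply: H. Qed.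

Lemma submodZ M (S : set M) a x : is_submodule S -> S x -> S (a *: x).
Proof. by case=> S0 H Sx; rewrite -[_ *: _]addr0; apply: H. Qed.

Lemma submodN M (S : set M) x : is_submodule S -> S x -> S (- x).
Proof. by move=> hS Sx; rewrite -scaleN1r; apply: submodZ. Qed.

Lemma submodB M (S : set M) x y : is_submodule S -> S x -> S y -> S (x - y).
Proof. by move=> hS Sx Sy; apply: submodD => //; apply: submodN. Qed.

Lemma submodT M : is_submodule (setT : set M).
Proof. by []. Qed.

Lemma submod_set0 M : is_submodule ([set 0] : set M).
Proof. by split=> // a x y /= -> ->; rewrite scaler0 addr0. Qed.

Lemma submodI M (S T : set M) :
  is_submodule S -> is_submodule T -> is_submodule (S `&` T).
Proof.
by move=> [S0 hS] [T0 hT]; split=> // a x y [? ?] [? ?]; split; [apply: hS|apply: hT].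
Qed.

Lemma submod_preim M N (f : {linear M -> N}) (S : set N) :
  is_submodule S -> is_submodule (f @^-1` S).
Proof.
move=> [S0 hS]; split; first by rewrite /= linear0.
by move=> a x y /= ? ?; rewrite linearP; apply: hS.
Qed.

Lemma submod_ker M N (f : {linear M -> N}) : is_submodule (ker f).
Proof. exact: submod_preim (submod_set0 N). Qed.

Lemma submod_image M N (f : {linear M -> N}) (S : set M) :
  is_submodule S -> is_submodule (f @` S).
Proof.
move=> [S0 hS]; split; first by exists 0; rewrite ?linear0.
by move=> a _ _ [x Sx <-] [y Sy <-]; exists (a *: x + y); [apply: hS|rewrite linearP].
Qed.

Definition sum_set M (S T : set M) : set M :=
  [set x | exists s t, [/\ S s, T t & x = s + t]].

Lemma submod_sum_set M (S T : set M) :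
  is_submodule S -> is_submodule T -> is_submodule (sum_set S T).
Proof.
move=> [S0 hS] [T0 hT]; split; first by exists 0, 0; rewrite addr0.
move=> a _ _ [s [t [Ss Tt ->]]] [s' [t' [Ss' Tt' ->]]].
exists (a *: s + s'), (a *: t + t'); split; [exact: hS|exact: hT|].
by rewrite scalerDr addrACA.
Qed.

Definition cyclic_set M (v : M) : set M := [set x | exists a : A, x = a *: v].

Lemma submod_cyclic M (v : M) : is_submodule (cyclic_set v).
Proof.
split; first by exists 0; rewrite scale0r.
by move=> a _ _ [b ->] [c ->]; exists (a * b + c); rewrite scalerDl scalerA.
Qed.

Lemma cyclic_self M (v : M) : cyclic_set v v.
Proof. by exists 1; rewrite scale1r. Qed.

Lemma linZ M N (f : {linear M -> N}) a x : f (a *: x) = a *: f x.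
Proof. exact: linearZ. Qed.

Lemma pair_linear M N P (f : {linear M -> N}) (g : {linear M -> P}) :
  linear (fun x => (f x, g x)).
Proof. by move=> a x y; rewrite !linearP. Qed.

Lemma inj_ker M N (f : {linear M -> N}) :
  (forall x, f x = 0 -> x = 0) -> injective f.
Proof.
move=> H x y fxy; apply/eqP; rewrite -subr_eq0; apply/eqP/H.
by rewrite linearB fxy subrr.
Qed.

Lemma inj0 M N (f : {linear M -> N}) x : injective f -> f x = 0 -> x = 0.
Proof. by move=> fI fx; apply: fI; rewrite fx linear0. Qed.

Lemma bij_of M N (f : M -> N) :
  injective f -> (forall y, exists x, f x = y) -> bijective f.
Proof.
move=> fI /choice[g gP]; exists g => // x; apply: fI; exact: gP.
Qed.

Lemma bij_surj M N (f : M -> N) : bijective f -> forall y, exists x, f x = y.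
Proof. by case=> g _ gK y; exists (g y). Qed.

Lemma lin_inv M N (f : {linear M -> N}) : bijective f ->
  exists g : {linear N -> M}, cancel f g /\ cancel g f.
Proof.
case=> g fK gK.
have gl : linear g.
  by move=> a x y; apply: (can_inj fK); rewrite linearP !gK.
by exists (lin_of gl).
Qed.

(** Any section [s] of [p] will do: since [f] kills the kernel of [p], the composite [f \o s] does
    not depend on the choice of [s], and so it is linear. *)
Lemma lin_factor M N P (p : {linear M -> N}) (f : {linear M -> P}) :
  (forall y, exists x, p x = y) -> (forall x, p x = 0 -> f x = 0) ->
  exists g : {linear N -> P}, forall x, g (p x) = f x.
Proof.
move=> /choice[s sP] pf.
have E x : f (s (p x)) = f x.
  apply/eqP; rewrite -subr_eq0 -linearB; apply/eqP/pf.
  by rewrite linearB sP subrr.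
have gl : linear (f \o s).
  by move=> a x y /=; rewrite -linearP -[RHS]E linearP !sP.
by exists (lin_of gl).
Qed.

Section Quotient.
Variables (M : lmodType A) (S : set M) (hS : is_submodule S).

Let canon (x : M) : M := xget 0 [set y | S (y - x)].

Let canonP x : S (canon x - x).
Proof. by apply: (@xgetPex _ 0 [set y | S (y - x)]); exists x; rewrite /= subrr; apply: submod0. Qed.

Let canon_eq x y : S (x - y) -> canon x = canon y.
Proof.
move=> Sxy; rewrite /canon; congr xget; apply/seteqP; split=> z /= Sz.
  by rewrite -[z - y](subrKA x); apply: submodD.
by rewrite -[z - x](subrKA y); apply: submodD=> //; rewrite -opprB; apply: submodN.
Qed.

Let canonK x : canon (canon x) = canon x.
Proof. exact: canon_eq (canonP x). Qed.

(** The fixed points of [canon] are one chosen representative per coset of [S], which gives M/S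
    without equivalence classes. *)
Definition quot := {x : M | canon x = x}.
HB.instance Definition _ := gen_eqMixin quot.
HB.instance Definition _ := gen_choiceMixin quot.

Let pi (x : M) : quot := exist _ (canon x) (canonK x).

Let val_inj' (u v : quot) : sval u = sval v -> u = v.
Proof. by case: u v => x px [y py] /= xy; apply: eq_exist. Qed.

Let piK (u : quot) : pi (sval u) = u.
Proof. by apply: val_inj'; case: u. Qed.

Let piE x y : S (x - y) -> pi x = pi y.
Proof. by move=> Sxy; apply: val_inj'; apply: canon_eq. Qed.

Let q0 := pi 0.
Let qN (u : quot) := pi (- sval u).
Let qD (u v : quot) := pi (sval u + sval v).
Let qZ a (u : quot) := pi (a *: sval u).

Let qND x : qN (pi x) = pi (- x).
Proof. by apply: piE; rewrite -opprD; exact: submodN hS (canonP x). Qed.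
Let qDD x y : qD (pi x) (pi y) = pi (x + y).
Proof. by apply: piE; rewrite opprD addrACA; exact: submodD hS (canonP x) (canonP y). Qed.
Let qZD a x : qZ a (pi x) = pi (a *: x).
Proof. by apply: piE; rewrite -scalerBr; exact: submodZ hS (canonP x). Qed.

Let qA : associative qD.
Proof. by move=> u v w; rewrite -(piK u) -(piK v) -(piK w) !qDD addrA. Qed.
Let qC : commutative qD.
Proof. by move=> u v; rewrite -(piK u) -(piK v) !qDD addrC. Qed.
Let q0D : left_id q0 qD.
Proof. by move=> u; rewrite -(piK u) qDD add0r. Qed.
Let qNK : left_inverse q0 qN qD.
Proof. by move=> u; rewrite -(piK u) qND qDD addNr. Qed.

HB.instance Definition _ := GRing.isZmodule.Build quot qA qC q0D qNK.

Let qZA a b u : qZ a (qZ b u) = qZ (a * b) u.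
Proof. by rewrite -(piK u) !qZD scalerA. Qed.
Let qZ1 : left_id 1 qZ.
Proof. by move=> u; rewrite -(piK u) !qZD scale1r. Qed.
Let qZDr : right_distributive qZ +%R.
Proof.
move=> a u v; rewrite -(piK u) -(piK v).
have D (u' v' : quot) : u' + v' = qD u' v' by [].
by rewrite !D qDD !qZD qDD scalerDr.
Qed.
Let qZDl u : {morph qZ^~ u : a b / a + b}.
Proof. 
move=> a b; rewrite -(piK u).
have D (u' v' : quot) : u' + v' = qD u' v' by [].
by rewrite D !qZD qDD scalerDl.
Qed.

HB.instance Definition _ := GRing.Zmodule_isLmodule.Build A quot qZA qZ1 qZDr qZDl.

Lemma quotient_exists : exists (Q : lmodType A) (p : {linear M -> Q}),
  (forall y, exists x, p x = y) /\ (forall x, p x = 0 <-> S x).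
Proof.
have pl : linear (pi : M -> quot).
  by move=> a x y; rewrite -[RHS]/(qD (qZ a (pi x)) (pi y)) qZD qDD.
exists quot, (lin_of pl); split=> [y|x]; first by exists (sval y); apply: piK.
split=> [/(congr1 sval) /= E|Sx]; last by apply: piE; rewrite subr0.
have := canonP x; rewrite [canon x]E => /(submodN hS).
rewrite opprB => /(submodD hS (canonP 0)).
by rewrite subr0 addrCA subrr addr0.
Qed.

End Quotient.

Section SubmoduleType.
Variables (M : lmodType A) (S : set M) (hS : is_submodule S).

Definition sub := {x : M | S x}.
HB.instance Definition _ := gen_eqMixin sub.
HB.instance Definition _ := gen_choiceMixin sub.

Let val_inj' (u v : sub) : sval u = sval v -> u = v.
Proof. by case: u v => x px [y py] /= xy; apply: eq_exist. Qed.

Let s0 : sub := exist _ 0 (submod0 hS).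
Let sN (u : sub) : sub := exist _ _ (submodN hS (svalP u)).
Let sD (u v : sub) : sub := exist _ _ (submodD hS (svalP u) (svalP v)).
Let sZ a (u : sub) : sub := exist _ _ (submodZ a hS (svalP u)).

Let sA : associative sD.
Proof. by move=> u v w; apply: val_inj'; rewrite /= addrA. Qed.
Let sC : commutative sD.
Proof. by move=> u v; apply: val_inj'; rewrite /= addrC. Qed.
Let s0D : left_id s0 sD.
Proof. by move=> u; apply: val_inj'; rewrite /= add0r. Qed.
Let sNK : left_inverse s0 sN sD.
Proof. by move=> u; apply: val_inj'; rewrite /= addNr. Qed.

HB.instance Definition _ := GRing.isZmodule.Build sub sA sC s0D sNK.

Let sZA a b u : sZ a (sZ b u) = sZ (a * b) u.
Proof. by apply: val_inj'; rewrite /= scalerA. Qed.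
Let sZ1 : left_id 1 sZ.
Proof. by move=> u; apply: val_inj'; rewrite /= scale1r. Qed.
Let sZDr : right_distributive sZ +%R.
Proof. by move=> a u v; apply: val_inj'; rewrite /= scalerDr. Qed.
Let sZDl u : {morph sZ^~ u : a b / a + b}.
Proof. by move=> a b; apply: val_inj'; rewrite /= scalerDl. Qed.

HB.instance Definition _ := GRing.Zmodule_isLmodule.Build A sub sZA sZ1 sZDr sZDl.

Lemma submodule_exists : exists (N : lmodType A) (i : {linear N -> M}),
  injective i /\ forall x, S x <-> exists y, i y = x.
Proof.
have il : linear (sval : sub -> M) by [].
exists sub, (lin_of il); split=> [u v /= /val_inj'//|x].
by split=> [Sx|[[y Sy] <-]] //; exists (exist _ x Sx).
Qed.

End SubmoduleType.

(** Zorn's lemma. In the applications [P] says that a submodule avoids a given vector or meets a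
    given image only in 0. *)
Lemma maximal_submodule M (W : set M) (P : set (set M)) :
  is_submodule W -> P W ->
  (forall F : set (set M), F !=set0 -> (forall T, F T -> P T) ->
     total_on F subset -> P (\bigcup_(T in F) T)) ->
  exists Z, [/\ is_submodule Z, W `<=` Z, P Z &
    forall T, is_submodule T -> P T -> Z `<=` T -> T = Z].
Proof.
move=> hW PW Pch.
pose ok := [set T | [/\ is_submodule T, W `<=` T & P T]].
pose X := {T : set M | ok T}.
pose R := fun (s t : X) => `[< sval s `<=` sval t >].
have [||||Z HZ] := @Zorn X R.
- by move=> t; apply/asboolP.
- by move=> r s t /asboolP rs /asboolP st; apply/asboolP; apply: subset_trans st.
- move=> [s ps] [t pt] /asboolP /= st /asboolP /= ts.
  by apply: eq_exist; apply/seteqP.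
- move=> F Ftot.
  have [[t0 Ft0]|F0] := pselect (F !=set0); last first.
    exists (exist ok W (And3 hW (@subset_refl _ W) PW)) => s Fs.
    by exfalso; apply: F0; exists s.
  pose G := [set sval s | s in F].
  have okU : ok (\bigcup_(T in G) T).
    split.
    - split; first by exists (sval t0); [exists t0|case: (svalP t0) => /submod0].
      move=> a x y [_ [s Fs <-] sx] [_ [t Ft <-] ty].
      have [/asboolP st|/asboolP ts] := Ftot _ _ Fs Ft.
        exists (sval t); first by exists t.
        by case: (svalP t) => ht _ _; apply: ht.2 => //; apply: st.
      exists (sval s); first by exists s.
      by case: (svalP s) => hs _ _; apply: hs.2 => //; apply: ts.
    - move=> x Wx; exists (sval t0); first by exists t0.
      by case: (svalP t0) => _ + _; apply.
    - apply: Pch; first by exists (sval t0), t0.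
        by move=> _ [s Fs <-]; case: (svalP s).
      move=> _ _ [s Fs <-] [t Ft <-].
      by case: (Ftot _ _ Fs Ft) => /asboolP; [left|right].
  exists (exist ok _ okU) => s Fs; apply/asboolP => x sx.
  by exists (sval s) => //; exists s.
case: (svalP Z) => hZ WZ PZ; exists (sval Z); split=> // T hT PT ZT.
have okT : ok T by split=> //; apply: subset_trans ZT.
by rewrite -(HZ (exist ok T okT)) //; apply/asboolP.
Qed.

End Submodules.

(** * Length *)
Section Length.
Variable A : pzRingType.
Implicit Types M N P : lmodType A.

(* There is a strict chain of submodules with n steps below S. *)
Fixpoint lge M (S : set M) (n : nat) : Prop :=
  if n is m.+1 then
    exists T, [/\ is_submodule T, T `<=` S, exists2 x, S x & ~ T x & lge T m]
  else True.

Definition fin_len M (S : set M) : Prop := exists n, ~ lge S n.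

Definition len M (S : set M) : nat := xget 0%N [set n | lge S n /\ ~ lge S n.+1].

Lemma lge_mono M (S S' : set M) n : S `<=` S' -> lge S n -> lge S' n.
Proof.
case: n => //= n SS' [T [hT TS [x Sx Tx] Tn]]; exists T; split=> //.
  exact: subset_trans SS'.
by exists x => //; apply: SS'.
Qed.

Lemma lgeW M (S : set M) m n : (m <= n)%N -> lge S n -> lge S m.
Proof.
move=> /subnK <-; elim: (n - m)%N => //= k IH [T [hT TS _ Tn]].
exact/IH/(lge_mono TS).
Qed.

Lemma lenP M (S : set M) n : fin_len S -> lge S n <-> (n <= len S)%N.
Proof.
move=> finS.
have [k1 k2] : [set n | lge S n /\ ~ lge S n.+1] (len S).
  case: finS => m Sm.
  apply: (@xgetPex _ 0%N [set n | lge S n /\ ~ lge S n.+1]).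
  elim: m Sm => [/(_ I)//|m IH Sm].
  by have [Sm'|/IH//] := pselect (lge S m); exists m.
split=> [Sn|le]; last exact: lgeW le k1.
by rewrite leqNgt; apply/negP => lt; apply: k2; apply: lgeW lt Sn.
Qed.

Lemma fin_lenS M (S T : set M) : S `<=` T -> fin_len T -> fin_len S.
Proof. by move=> ST [n Tn]; exists n => /(lge_mono ST). Qed.

Lemma len_le M (S T : set M) : S `<=` T -> fin_len T -> (len S <= len T)%N.
Proof.
by move=> ST fT; apply/lenP/(lge_mono ST)/lenP => //; apply: fin_lenS fT.
Qed.

Lemma len_lt M (S T : set M) x : is_submodule S -> S `<=` T -> T x -> ~ S x ->
  fin_len T -> (len S < len T)%N.
Proof.
move=> hS ST Tx Sx fT; apply/(lenP _ fT) => /=; exists S; split=> //; first by exists x.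
by apply/lenP => //; apply: fin_lenS fT.
Qed.

Lemma len_eq M (S T : set M) : is_submodule S -> S `<=` T -> fin_len T ->
  (len T <= len S)%N -> S = T.
Proof.
move=> hS ST fT le; apply/seteqP; split=> // x Tx.
apply: contrapT => Sx; have := len_lt hS ST Tx Sx fT.
by rewrite ltnNge le.
Qed.

Lemma lge1 M (S : set M) : is_submodule S -> (exists2 x, S x & x <> 0) <-> lge S 1.
Proof.
move=> hS; split=> [[x Sx x0]|[T [hT TS [x Sx Tx] _]]].
  exists [set 0]; split=> //; first exact: submod_set0.
    by move=> _ ->; apply: submod0.
  by exists x.
by exists x => // x0; apply: Tx; rewrite x0; apply: submod0.
Qed.

Lemma len0P M (S : set M) : is_submodule S -> fin_len S ->
  len S = 0%N <-> forall x, S x -> x = 0.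
Proof.
move=> hS fS; split=> [S0 x Sx|S0].
  apply: contrapT => x0.
  have /(lge1 hS)/(lenP _ fS) : exists2 x, S x & x <> 0 by exists x.
  by rewrite S0.
apply/eqP; rewrite -leqn0 leqNgt; apply/negP => /(lenP _ fS)/(lge1 hS)[x Sx].
by move/S0: Sx.
Qed.

(** A strict step T < S stays strict in the kernel or in the image of [f]: if every element of S in
    the kernel lies in T, then [f x], for x in S outside T, is not in f(T). *)
Lemma lge_split M N (f : {linear M -> N}) (S : set M) n : is_submodule S -> lge S n ->
  exists i j, [/\ (i + j)%N = n, lge (S `&` ker f) i & lge (f @` S) j].
Proof.
elim: n S => [|n IH] S hS; first by exists 0%N, 0%N.
move=> [T [hT TS [x Sx Tx] /(IH _ hT)[i [j [ij Ti Tj]]]]].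
have [[y [Sy ky] Ty]|H] := pselect (exists2 y, (S `&` ker f) y & ~ T y).
  exists i.+1, j; split; [by rewrite addSn ij| |apply: lge_mono Tj].
    exists (T `&` ker f); split=> //; first exact: submodI (submod_ker f).
      by move=> z [/TS].
    by exists y => // -[].
  by move=> _ [z /TS Sz <-]; exists z.
exists i, j.+1; split; first by rewrite addnS ij.
  by apply: lge_mono Ti => z [/TS].
exists (f @` T); split=> //; first exact: submod_image.
  by move=> _ [z /TS Sz <-]; exists z.
exists (f x); first by exists x.
move=> [t Tt ftx]; apply: H; exists (x - t).
  by split; [apply: submodB => //; exact: TS|rewrite /ker /= linearB ftx subrr].
by move=> Txt; apply: Tx; rewrite -(subrK t x); apply: submodD.
Qed.

(** A chain in the image is pulled back inside [S]. All its terms contain the kernel part of [S], so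
    the chain in the kernel continues it downwards. *)
Lemma lge_glue M N (f : {linear M -> N}) (S : set M) i j : is_submodule S ->
  lge (S `&` ker f) i -> lge (f @` S) j -> lge S (i + j).
Proof.
move=> + + H; elim: j S H => [|j IH] S.
  by move=> _ _ Si; rewrite addn0; apply: lge_mono Si => x [].
move=> [T [hT TS [_ [x Sx <-] Tx] Tj]] hS Si; rewrite addnS.
exists (S `&` f @^-1` T); split.
- exact: submodI (submod_preim f hT).
- by move=> z [].
- by exists x => // -[].
apply: IH.
- apply: lge_mono Tj => y Ty; have [z Sz fz] := TS _ Ty.
  by exists z => //; split => //=; rewrite fz.
- exact: submodI (submod_preim f hT).
apply: lge_mono Si => z [Sz kz]; split=> //; split=> //=.
by rewrite kz; apply: submod0.
Qed.

Lemma fin_len_ext M N (f : {linear M -> N}) (S : set M) : is_submodule S ->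
  fin_len (S `&` ker f) -> fin_len (f @` S) -> fin_len S.
Proof.
move=> hS [i Si] [j Sj]; exists (i + j)%N => /(lge_split f hS)[k [l [kl Sk Sl]]].
have [ik|ki] := leqP i k; first by apply/Si/lgeW/Sk.
by apply: Sj; apply: lgeW Sl; lia.
Qed.

Lemma fin_len_image M N (f : {linear M -> N}) (S : set M) : is_submodule S ->
  fin_len S -> fin_len (f @` S).
Proof. by move=> hS [n Sn]; exists n => H; apply: Sn; apply: (lge_glue (i := 0%N) hS) H. Qed.

Lemma len_add M N (f : {linear M -> N}) (S : set M) : is_submodule S -> fin_len S ->
  len S = (len (S `&` ker f) + len (f @` S))%N.
Proof.
move=> hS fS; have fI := fin_len_image f hS fS.
have fK : fin_len (S `&` ker f) by apply: fin_lenS fS => x [].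
apply/eqP; rewrite eqn_leq; apply/andP; split.
  have /(lenP _ fS)/(lge_split f hS)[i [j [<- Si Sj]]] := leqnn (len S).
  by apply: leq_add; apply/lenP.
by apply/(lenP _ fS)/(lge_glue (f := f) hS); apply/lenP.
Qed.

Lemma len_inj M N (f : {linear M -> N}) (S : set M) : is_submodule S ->
  injective f -> fin_len S -> len (f @` S) = len S.
Proof.
move=> hS fI fS; rewrite (len_add f hS fS) (_ : len (S `&` ker f) = 0%N) //.
apply/len0P; [exact: submodI (submod_ker f)|by apply: fin_lenS fS => x []|].
by move=> x [_ /(inj0 fI)].
Qed.

Lemma len_image_le M N (f : {linear M -> N}) (S : set M) : is_submodule S ->
  fin_len S -> (len (f @` S) <= len S)%N.
Proof. by move=> hS fS; rewrite (len_add f hS fS) leq_addl. Qed.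

Lemma fin_len_inj M N (f : {linear M -> N}) (S : set M) : is_submodule S ->
  injective f -> fin_len (f @` S) -> fin_len S.
Proof.
move=> hS fI; apply: fin_len_ext => //; exists 1%N => /lge1[].
  exact: submodI (submod_ker f).
by move=> x [_ /(inj0 fI)].
Qed.

Definition finite M : Prop := fin_len (setT : set M).
Definition mlen M : nat := len (setT : set M).

Lemma finS M (S : set M) : finite M -> fin_len S.
Proof. exact: fin_lenS. Qed.

Lemma mlen_le M (S : set M) : finite M -> (len S <= mlen M)%N.
Proof. exact: len_le. Qed.

Lemma finite_inj M N (f : {linear M -> N}) : injective f -> finite N -> finite M.
Proof.
by move=> fI fN; apply: (fin_len_inj (submodT M) fI); apply: finS.
Qed.

Lemma surj_image M N (f : M -> N) : (forall y, exists x, f x = y) ->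
  f @` setT = setT.
Proof. by move=> fS; apply/seteqP; split=> // y _; have [x <-] := fS y; exists x. Qed.

Lemma finite_surj M N (f : {linear M -> N}) : (forall y, exists x, f x = y) ->
  finite M -> finite N.
Proof. by move=> fS fM; rewrite /finite -(surj_image fS); apply: fin_len_image. Qed.

Lemma mlen_inj M N (f : {linear M -> N}) : injective f -> finite N ->
  (mlen M <= mlen N)%N.
Proof.
move=> fI fN; rewrite /mlen -(len_inj (submodT M) fI) ?mlen_le //.
exact: finite_inj fI fN.
Qed.

Lemma mlen_inj_bij M N (f : {linear M -> N}) : injective f -> finite N ->
  (mlen N <= mlen M)%N -> bijective f.
Proof.
move=> fI fN le; apply: bij_of => // y.
have : (f @` setT) y.
  rewrite (_ : f @` setT = setT) //; apply: len_eq => //; first exact: submod_image.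
  by rewrite len_inj //; apply: finite_inj fI fN.
by case=> x _ <-; exists x.
Qed.

Lemma mlen_iso M N : isomorphic M N -> finite N -> mlen M = mlen N.
Proof.
move=> [f fb] fN; have [g [fK gK]] := lin_inv fb; apply/eqP; rewrite eqn_leq.
by rewrite (mlen_inj (can_inj fK)) // (mlen_inj (can_inj gK)) //; apply: finite_inj (can_inj fK) fN.
Qed.

Lemma finite_prod M N : finite M -> finite N -> finite (M * N)%type.
Proof.
move=> fM fN; apply: (@fin_len_ext _ _ (@snd M N) _ (submodT _)); last exact: finS.
apply: (@fin_len_ext _ _ (@fst M N)); last exact: finS.
  exact: submodI (submodT _) (submod_ker _).
exists 1%N => /lge1[]; first by do ?apply: submodI; rewrite //; exact: submod_ker.
by case=> x y [[_ /= ky] /= kx]; case; rewrite /ker /= in kx ky; rewrite kx ky.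
Qed.

Lemma scaler_linear M (v : M) : linear (fun a : A^o => (a : A) *: v).
Proof. by move=> a x y; rewrite scalerDl scalerA. Qed.

Lemma fin_len_sum M (S T : set M) : is_submodule S -> is_submodule T ->
  fin_len S -> fin_len T -> fin_len (sum_set S T).
Proof.
move=> hS hT fS fT.
have [Q [p [pS pk]]] := quotient_exists hS.
apply: (@fin_len_ext _ _ p); first exact: submod_sum_set.
  by apply: fin_lenS fS => x [_ /pk].
apply: fin_lenS (fin_len_image p hT fT).
by move=> _ [_ [s [t [/pk Ss Tt ->]]] <-]; exists t => //; rewrite linearD Ss add0r.
Qed.

Lemma finite_span P M (n : nat) (f : 'I_n -> {linear P -> M}) : finite P ->
  (forall x : M, exists c : 'I_n -> P, x = \sum_i f i (c i)) -> finite M.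
Proof.
move=> fP fS.
suff H : forall m, (m <= n)%N -> fin_len [set x | exists c : 'I_n -> P,
    x = \sum_(i < n | (i < m)%N) f i (c i)].
  apply: fin_lenS (H n (leqnn n)) => x _; have [c ->] := fS x; exists c.
  by apply: eq_bigl => i; rewrite ltn_ord.
elim=> [_|m IH mn].
  exists 1%N => -[T [hT _ [x [c ->]]]]; rewrite big_pred0 // => H _.
  by apply: H; apply: submod0.
have {}IH := IH (ltnW mn); pose im := Ordinal mn.
have hf : is_submodule (f im @` setT) by apply: submod_image.
apply: fin_lenS (fin_len_sum _ hf IH (fin_len_image _ (submodT P) fP)).
  move=> _ [c ->]; exists (\sum_(i < n | (i < m)%N) f i (c i)), (f im (c im)).
  split; [by exists c|by exists (c im)|].
  rewrite (bigD1 im) //= addrC; congr (_ + _); apply: eq_bigl => i.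
  by rewrite -val_eqE /= ltnS; lia.
split; first by exists (fun _ => 0); rewrite big1 // => i _; rewrite linear0.
move=> a _ _ [c ->] [d ->]; exists (fun i => a *: c i + d i).
by rewrite scaler_sumr -big_split; apply: eq_bigr => i _; rewrite linearP.
Qed.

Lemma finitely_generated_finite M : finite A^o -> finitely_generated M -> finite M.
Proof.
move=> fA [n [v vP]].
exact: (finite_span (f := fun i => lin_of (scaler_linear (v i))) fA).
Qed.

Lemma finite_ffun M (I : finType) : finite M -> finite {ffun I -> M}.
Proof.
move=> fM.
have dl (i : I) : linear (fun x : M => [ffun j => if j == i then x else 0]).
  by move=> a x y; apply/ffunP => j; rewrite !ffunE; case: eqP => _; rewrite ?scaler0 ?addr0.
apply: (finite_span (f := fun k => lin_of (dl (enum_val k))) fM) => z.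
exists (fun k => z (enum_val k)); rewrite -(big_enum_val (fun i => [ffun j => if j == i then z i else 0] : {ffun I -> M})).
apply/ffunP => j; rewrite sum_ffunE (bigD1 j) //= ffunE eqxx big1 ?addr0 // => i ij.
by case/andP: ij => _ ij; rewrite ffunE eq_sym (negPf ij).
Qed.

(** Induction on the length: divide by a nonzero cyclic submodule, lift generators of the quotient
    and add the generator [x] of that submodule. *)
Lemma fin_len_gens M (S : set M) : is_submodule S -> fin_len S ->
  exists (p : nat) (g : 'I_p -> M), (forall i, S (g i)) /\
    forall x, S x -> exists c : 'I_p -> A, x = \sum_i c i *: g i.
Proof.
move=> hS fS; have [n le] := ubnP (len S).
elim: n => // n IH in M S hS fS le *.
have [[x Sx x0]|S0] := pselect (exists2 x, S x & x <> 0); last first.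
  exists 0%N, (fun _ => 0); split=> [[]//|x Sx]; exists (fun _ => 0).
  rewrite big_ord0; apply: contrapT => x0; apply: S0; by exists x.
have [Q [p [pS pk]]] := quotient_exists (submod_cyclic x).
have hpS := submod_image p hS.
suff [k [g [gS gP]]] : exists (k : nat) (g : 'I_k -> Q), (forall i, (p @` S) (g i)) /\
    forall x, (p @` S) x -> exists c : 'I_k -> A, x = \sum_i c i *: g i.
  have /choice[h hP] i : exists s, S s /\ p s = g i by have [s Ss <-] := gS i; exists s.
  exists k.+1, (fun i => if unlift ord0 i is Some j then h j else x); split=> [i|y Sy].
    by case: unliftP => [j _|//]; apply: (hP j).1.
  have [|c pc] := gP (p y); first by exists y.
  have : p (y - \sum_i c i *: h i) = 0.
    rewrite linearB linear_sum pc; apply/eqP; rewrite subr_eq0; apply/eqP.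
    by apply: eq_bigr => i _; rewrite linearZ (hP i).2.
  move=> /pk[a ya]; exists (fun i => if unlift ord0 i is Some j then c j else a).
  rewrite big_ord_recl unlift_none -ya -[LHS](subrK (\sum_i c i *: h i)); congr (_ + _).
  by apply: eq_bigr => i _; rewrite liftK.
apply: IH => //; first exact: fin_len_image.
rewrite (len_add p hS fS) in le.
suff : len (S `&` ker p) <> 0%N by lia.
move/len0P => H; apply: x0; apply: H.
- exact: submodI (submod_ker p).
- by apply: fin_lenS fS => ? [].
by split=> //; apply/pk/cyclic_self.
Qed.

Lemma finite_finitely_generated M : finite M -> finitely_generated M.
Proof.
move=> /(fin_len_gens (submodT M))[p [g [_ gP]]].
by exists p, g => x; apply: gP.
Qed.

End Length.

(** * A duality for modules over a commutative artinian ring *)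
Section Artinian.
Variable R : comNzRingType.

(** Without a minimal member, dependent choice would give a strictly descending sequence of
    ideals. *)
Lemma artinian_minimal (P : set (set R)) : artinian_ring R ->
  (exists2 J, is_ideal J & P J) ->
  exists J, [/\ is_ideal J, P J &
    forall K, is_ideal K -> P K -> K `<=` J -> K = J].
Proof.
move=> artR [J0 hJ0 PJ0]; apply: contrapT => nomin.
pose T := {J : set R | is_ideal J /\ P J}.
have /choice[s sP] (J : T) : exists K : T, sval K `<=` sval J /\ sval K <> sval J.
  apply: contrapT => nK; apply: nomin; exists (sval J).
  case: (svalP J) => hJ PJ; split=> // K hK PK KJ; apply: contrapT => neq.
  by apply: nK; exists (exist _ K (conj hK PK)).
pose u n : T := iter n s (exist _ J0 (conj hJ0 PJ0)).
have [n|n|n /(_ n.+1 (leqnSn n))] := artR (fun n => sval (u n)).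
- by case: (svalP (u n)).
- by have [] := sP (u n).
by have [] := sP (u n).
Qed.

(** Hopkins-Levitzki for commutative rings. Take I minimal among the kernels of maps from R to
    modules of finite length. If I were nonzero, it would contain a proper subideal I' with I/I' of
    length at most one, and I' would be such a kernel too. *)
Lemma artinian_finite : artinian_ring R -> finite R^o.
Proof.
move=> artR.
pose cofin (I : set R) := exists (N : lmodType R) (f : {linear R^o -> N}),
  finite N /\ forall r, f r = 0 <-> I r.
have [|I [hI [N [f [fN fI]]] minI]] := artinian_minimal (P := cofin) artR.
  exists setT; first exact: submodT.
  have [Q [p [pS pk]]] := quotient_exists (submodT R^o).
  exists Q, p; split=> //; exists 1%N => /(lge1 (submodT Q))[y _ y0]; apply: y0.
  by have [x <-] := pS y; apply/pk.
have [I0|/existsNP[i1 /not_implyP[Ii1 i1n0]]] := pselect (forall i, I i -> i = 0).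
  by apply: finite_inj fN; apply: inj_ker => x /fI/I0.
exfalso.
(* [K] is minimal among the ideals that do not annihilate I. Hence r x generates [K], and in
   particular x, as soon as r x I is nonzero. *)
have [|K [hK [x [i0 [Kx Ii0 xi0]]] minK]] := artinian_minimal
    (P := fun K => exists x i, [/\ K x, I i & x * i <> 0]) artR.
  exists setT; first exact: submodT.
  by exists 1, i1; rewrite mul1r.
have alt r : (forall i, I i -> r * x * i = 0) \/ exists r', x = r' * r * x.
  have [H|/existsNP[i /not_implyP[Ii rxi]]] := pselect (forall i, I i -> r * x * i = 0).
    by left.
  right; have : K x by [].
  rewrite -(minK (cyclic_set (r * x : R^o))).
  - by case=> a E; exists a; rewrite -mulrA; exact: E.
  - exact: submod_cyclic.
  - by exists (r * x), i; split=> //; exists 1; rewrite scale1r.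
  by move=> _ [a ->]; apply: submodZ => //; apply: (submodZ (M := R^o)).
pose v := x * i0.
(* [W] is maximal among the ideals avoiding v = x i0, so v lies in W + J for every ideal J not
   contained in [W]. *)
have [||W [hW _ Wv maxW]] := maximal_submodule (submod_set0 R^o) (P := fun T : set R^o => ~ T (v : R^o)).
- exact: xi0.
- by move=> F _ FP _ [T /FP Tv /Tv].
(* Modulo [W] the ideal x I is simple: x i and x j both have a multiple congruent to v, and the
   equation x = r' r2 x from [alt] leads back from v to x j. *)
have key i j : I i -> I j -> ~ W (x * i) -> exists r, W (x * j - r * (x * i)).
  have toV i' : I i' -> ~ W (x * i') -> exists2 r, W (v - r * (x * i')) & exists r', x = r' * r * x.
    move=> Ii' Wi'; apply: contrapT => nr.
    apply: Wi'; rewrite -(maxW (sum_set W (cyclic_set (x * i' : R^o)))).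
    - exists 0, (x * i'); split; [exact: submod0|exact: cyclic_self|by rewrite add0r].
    - exact: submod_sum_set (submod_cyclic _).
    - move=> [w [_ [Ww [r ->] E]]]; apply: nr; exists r; first by rewrite E addrK.
      case: (alt r) => // rx0; exfalso; apply: Wv; rewrite E.
      by rewrite [r *: _]mulrA rx0 // addr0.
    move=> w Ww; exists w, 0; split=> //; last by rewrite addr0.
    by exists 0; rewrite scale0r.
  move=> Ii Ij Wi.
  have [Wj|Wj] := pselect (W (x * j)); first by exists 0; rewrite mul0r subr0.
  have [r Wr _] := toV _ Ii Wi; have [r2 Wr2 [r' xr']] := toV _ Ij Wj.
  exists (r' * r).
  have -> : x * j - r' * r * (x * i) = r' * ((v - r * (x * i)) - (v - r2 * (x * j))).
    by rewrite opprB [X in _ = r' * X]addrC subrKA mulrBr !mulrA -xr'.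
  exact: (submodZ (M := R^o) r' hW (submodB hW Wr Wr2)).
have hI' : is_ideal [set i | I i /\ W (x * i)].
  split; first by split; [exact: submod0 hI|rewrite mulr0; exact: submod0 hW].
  move=> a i j [Ii Wi] [Ij Wj]; split; first exact: hI.2.
  rewrite mulrDr -[x * (a *: i)]mulrCA; exact: hW.2.
have [Q [p [pS pk]]] := quotient_exists (hI' : is_submodule (_ : set R^o)).
have [|g gP] := lin_factor (f := f) pS; first by move=> r /pk[/fI].
(* The kernel of [g] is I/I', of length at most one by [key]. *)
have fQ : finite Q.
  apply: (fin_len_ext (f := g) (submodT Q)); last exact: finS.
  exists 2%N => -[T [hT TS [z [_ kz] Tz] /(lge1 hT)[u Tu u0]]]; apply: Tz.
  have [i pi] := pS u; have [j pj] := pS z.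
  have Ii : I i by apply/fI; rewrite -gP pi; case: (TS _ Tu).
  have Ij : I j by apply/fI; rewrite -gP pj.
  have Wi : ~ W (x * i) by move=> Wi; apply: u0; rewrite -pi; apply/pk.
  have [r Wr] := key _ _ Ii Ij Wi.
  rewrite -pj (_ : p j = r *: u); first exact: submodZ.
  apply/eqP; rewrite -subr_eq0 -pi -linearZ -linearB; apply/eqP/pk; split.
    by apply: (submodB (M := R^o)) => //; apply: (submodZ (M := R^o)).
  by rewrite mulrBr [x * (r *: i)]mulrCA.
have E : [set i | I i /\ W (x * i)] = I.
  by apply: minI => //; [exists Q, p|move=> i []].
by apply: Wv; move: Ii0; rewrite -E => -[].
Qed.

End Artinian.

(** * A cogenerator with multiplicity-free socle, and reflexivity *)

Section Cogenerator.
Variable R : comNzRingType.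
Hypothesis fR : finite R^o.
Implicit Types E N P X : lmodType R.

Definition simple_elt N (s : N) :=
  s <> 0 /\ forall r, r *: s = 0 \/ exists r', r' *: (r *: s) = s.

(* Each simple R-module occurs at most once in the socle of N. *)
Definition socle_mult_free N := forall e e' : N, simple_elt e ->
  (forall r, r *: e = 0 -> r *: e' = 0) -> exists r, e' = r *: e.

Lemma simple_elt_map N P (f : {linear N -> P}) s :
  simple_elt s -> f s <> 0 -> simple_elt (f s).
Proof.
move=> [s0 sP] fs; split=> // r; case: (sP r) => [rs|[r' rs]]; [left|right].
  by rewrite -(linZ f) rs linear0.
by exists r'; rewrite -!(linZ f) rs.
Qed.

(** The annihilator of [s] is a maximal ideal, so it equals every proper ideal containing it, such
    as the annihilator of [t]. *)
Lemma simple_elt_ann N P (s : N) (t : P) r : simple_elt s ->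
  (forall r, r *: s = 0 -> r *: t = 0) -> t <> 0 -> r *: t = 0 -> r *: s = 0.
Proof.
move=> [s0 sP] st t0 rt; case: (sP r) => // -[r' rs]; exfalso; apply: t0.
have : (r' * r - 1) *: t = 0 by apply: st; rewrite scalerBl -scalerA rs scale1r subrr.
by rewrite scalerBl -scalerA rt scaler0 scale1r sub0r => /eqP; rewrite oppr_eq0 => /eqP.
Qed.

Lemma simple_elt_of_ann N P (s : N) (t : P) : simple_elt s ->
  (forall r, r *: s = 0 -> r *: t = 0) -> t <> 0 -> simple_elt t.
Proof.
move=> [s0 sP] st t0; split=> // r; case: (sP r) => [/st|[r' rs]]; first by left.
right; exists r'.
have : (r' * r - 1) *: t = 0 by apply: st; rewrite scalerBl -scalerA rs scale1r subrr.
by rewrite scalerBl scale1r -scalerA => /eqP; rewrite subr_eq0 => /eqP.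
Qed.

Lemma simple_elt_exists N : finite N -> (exists x : N, x <> 0) ->
  exists s : N, simple_elt s.
Proof.
move=> fN [x x0].
have [n le] := ubnP (len (cyclic_set x)); elim: n => // n IH in x x0 le *.
have [sx|nsx] := pselect (simple_elt x); first by exists x.
have [r /not_orP[rx nr']] : exists r, ~ (r *: x = 0 \/ exists r', r' *: (r *: x) = x).
  by apply/existsNP => H; apply: nsx.
apply: (IH (r *: x)) => //; rewrite ltnS in le; apply: leq_trans le.
apply: (@len_lt _ _ _ _ x); [exact: submod_cyclic| |exact: cyclic_self| |exact: finS].
  by move=> _ [a ->]; exists (a * r); rewrite scalerA.
by move=> [a xa]; apply: nr'; exists a.
Qed.

(** For an ideal I this is Hom_R(R/I, N), a map being identified with its value at the class of
    1. *)
Definition annih N (I : set R^o) : set N := [set y | forall a, I a -> a *: y = 0].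

Lemma submod_annih N I : is_submodule (annih I : set N).
Proof.
split=> [a _|a x y Ix Iy b Ib]; first exact: scaler0.
by rewrite scalerDr scalerA mulrC -scalerA Ix // Iy // scaler0 addr0.
Qed.

Lemma scale_linear N (a : R) : linear (fun y : N => a *: y).
Proof. by move=> b x y; rewrite scalerDr !scalerA mulrC. Qed.

(** Induction on the length of R/I. If (I + R a)/I is simple, multiplication by [a] on [annih I] has
    its kernel inside [annih (J a)] and an image of length at most one. *)
Lemma annih_len N I : finite N -> socle_mult_free N -> is_submodule I ->
  (len (annih I : set N) + len I <= mlen R^o)%N.
Proof.
move=> fN socN; have [n le] := ubnP (mlen R^o - len I).
elim: n => // n IH in I le * => hI.
have [IT|/existsNP[a0 Ia0]] := pselect (forall a, I a).
  rewrite (_ : len (annih I) = 0%N); first exact: mlen_le.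
  apply/len0P; [exact: submod_annih|exact: finS|].
  by move=> x /(_ 1 (IT 1)); rewrite scale1r.
pose J a := sum_set I (cyclic_set (a : R^o)).
have hJ a : is_submodule (J a) by apply: submod_sum_set (submod_cyclic _).
have IJ a : I `<=` J a.
  by move=> i Ii; exists i, 0; split=> //; [exists 0; rewrite scale0r|rewrite addr0].
have Ja a : J a a.
  by exists 0, a; split; [exact: submod0|exact: cyclic_self|rewrite add0r].
(* Shrinking I + R a as long as possible makes (I + R a)/I simple. *)
have [a Ia aP] : exists2 a, ~ I a & forall r, I (r * a) \/ exists2 r', I (a - r' * (r * a)) & True.
  have [k lek] := ubnP (len (J a0)); elim: k => // k IHk in a0 Ia0 lek *.
  apply: contrapT => na.
  have [r /not_orP[ra nr']] : exists r, ~ (I (r * a0) \/ exists2 r', I (a0 - r' * (r * a0)) & True).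
    by apply/existsNP => H; apply: na; exists a0.
  apply: na; apply: (IHk (r * a0)) => //; rewrite ltnS in lek; apply: leq_trans lek.
  apply: (@len_lt _ _ _ _ a0) => //; last exact: finS.
    move=> _ [i [_ [Ii [b ->] ->]]]; exists i, ((b * r) *: (a0 : R^o)).
    by split=> //; [exists (b * r)|rewrite -scalerA].
  by move=> [i [_ [Ii [b ->] E]]]; apply: nr'; exists b => //; rewrite {1}E addrK.
have IJlt : (len I < len (J a))%N.
  by apply: (@len_lt _ _ _ _ a) => //; apply: finS.
have leJ : (len (J a) <= mlen R^o)%N by apply: mlen_le.
have {}IH := IH (J a) _ (hJ a).
rewrite (len_add (lin_of (@scale_linear N a)) (@submod_annih _ _) (finS _ fN)).
have le1 : (len (annih I `&` ker (lin_of (@scale_linear N a))) <= len (annih (J a) : set N))%N.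
  apply: len_le; last exact: finS.
  move=> y [Iy /= ay] _ [i [_ [Ii [b ->] ->]]].
  by rewrite scalerDl Iy // add0r -scalerA [a *: y]ay scaler0.
(* The image is killed by the maximal ideal (I : a), so its elements all have the same simple type,
   which occurs at most once in the socle of N. *)
suff : (len (lin_of (@scale_linear N a) @` annih I) <= 1)%N.
  have := IH _; lia.
rewrite leqNgt; apply/negP => /(lenP _ (finS _ fN)).
move=> [T [hT TS [_ [z Iz <-] Tz] /(lge1 hT)[u Tu u0]]]; apply: Tz.
have [y Iy ay] := TS _ Tu; rewrite /= in ay.
have alt r (y' : N) : annih I y' -> r *: (a *: y') = 0 \/ exists r', r' *: (r *: (a *: y')) = a *: y'.
  move=> Iy'; case: (aP r) => [/Iy'|[r' /Iy' E _]]; first by left; rewrite scalerA.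
  right; exists r'; apply/eqP; rewrite eq_sym -subr_eq0; apply/eqP; rewrite -[RHS]E.
  by rewrite scalerBl !scalerA mulrA.
have su : simple_elt u by split=> // r; rewrite -ay; apply: alt.
have [r rP|r E] := socN u (a *: z) su; last by rewrite /= E; apply: submodZ.
case: (aP r) => [/Iz|[r' /Iy E _]]; first by rewrite scalerA.
exfalso; apply: u0; rewrite -ay.
by move: E; rewrite scalerBl -!scalerA ay rP scaler0 subr0.
Qed.

Lemma socle_mult_free_len N : finite N -> socle_mult_free N -> (mlen N <= mlen R^o)%N.
Proof.
move=> fN socN; have := annih_len fN socN (submod_set0 R^o).
apply: leq_trans; apply: leq_trans (leq_addr _ _).
apply: len_le; last exact: finS.
by move=> y _ _ ->; rewrite scale0r.
Qed.

(** The lengths in question are bounded by that of R, and the zero module shows that some length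
    occurs. *)
Lemma maximal_socle_mult_free : exists E, [/\ finite E, socle_mult_free E &
  forall N, finite N -> socle_mult_free N -> (mlen N <= mlen E)%N].
Proof.
pose p n := `[< exists E, [/\ finite E, socle_mult_free E & mlen E = n] >].
have ex : exists n, p n.
  have z (x y : 'rV[R]_0) : x = y by rewrite [x]thinmx0 [y]thinmx0.
  exists (mlen 'rV[R]_0); apply/asboolP; exists 'rV[R]_0; split=> //.
    by exists 1%N => /(lge1 (submodT _))[x _]; apply.
  by move=> e e'; exists 0.
have ub n : p n -> (n <= mlen R^o)%N.
  by move=> /asboolP[E [fE sE <-]]; apply: socle_mult_free_len.
case: (ex_maxnP ex ub) => n /asboolP[E [fE sE En]] nP; exists E; split=> // N fN sN.
by rewrite En; apply: nP; apply/asboolP; exists N.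
Qed.

(** Dividing P by a submodule maximal among those meeting the image of E trivially makes the
    embedding of E essential. Simple elements of the quotient then come from E, so the socle does
    not grow. *)
Lemma essential_quotient E P (i : {linear E -> P}) : injective i ->
  socle_mult_free E -> exists E' (q : {linear P -> E'}),
  [/\ forall y, exists x, q x = y, injective (q \o i) & socle_mult_free E'].
Proof.
move=> iI sE.
have [e /(inj0 iI)//||Z [hZ _ Zi maxZ]] := maximal_submodule (submod_set0 P)
  (P := fun T => forall e, T (i e) -> e = 0).
  by move=> F _ FP _ e [T /FP]; apply.
have [E' [q [qS qk]]] := quotient_exists hZ.
have qiI : injective (q \o i) by apply: inj_ker => e /= /qk/Zi.
exists E', q; split=> //.
have ess y : simple_elt y -> exists e, q (i e) = y.
  move=> [y0 yP]; have [x xy] := qS y.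
  have [[r [e [rye e0]]]|H] := pselect (exists r e, r *: y = q (i e) /\ e <> 0).
    case: (yP r) => [ry|[r' <-]].
      by exfalso; apply/e0/qiI; rewrite /= -rye ry !linear0.
    by exists (r' *: e); rewrite (linZ i) (linZ q) rye.
  exfalso; apply: y0; rewrite -xy; apply/qk.
  rewrite -(maxZ (sum_set Z (cyclic_set x))).
  - by exists 0, x; split; [exact: submod0|exact: cyclic_self|rewrite add0r].
  - exact: submod_sum_set (submod_cyclic _).
  - move=> e [z [_ [Zz [r ->] Ei]]]; apply: contrapT => e0; apply: H.
    by exists r, e; split=> //; rewrite Ei linearD (linZ q) xy ((qk z).2 Zz) add0r.
  move=> z Zz; exists z, 0; split=> //; last by rewrite addr0.
  by exists 0; rewrite scale0r.
move=> e1 e2 s1 a12.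
have [->|e20] := pselect (e2 = 0); first by exists 0; rewrite scale0r.
have [e3 E3] := ess _ s1.
have [e4 E4] := ess _ (simple_elt_of_ann s1 a12 e20).
have qi0 r e : r *: q (i e) = 0 <-> r *: e = 0.
  split=> [H|H]; last by rewrite -(linZ q) -(linZ i) H !linear0.
  by apply: qiI; rewrite /= (linZ i) (linZ q) H !linear0.
have [|r re|r E34] := sE e3 e4; last by exists r; rewrite -E4 -E3 E34 (linZ i) (linZ q).
  split=> [E30|r]; first by case: s1 => e10 _; apply: e10; rewrite -E3 E30 !linear0.
  have := s1.2 r; rewrite -E3 => -[/qi0|[r' Er]]; first by left.
  by right; exists r'; apply: qiI; rewrite /= !(linZ i) !(linZ q).
by apply/qi0; rewrite E4; apply: a12; rewrite -E3; apply/qi0.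
Qed.

Definition cogenerator E := forall N (W : set N) (v : N), finite N ->
  is_submodule W -> ~ W v ->
  exists th : {linear N -> E}, (forall w, W w -> th w = 0) /\ th v <> 0.

(* E is the injective hull of the direct sum of the simple R-modules: a proper
   essential extension of E would be a longer module with multiplicity-free socle. *)
Lemma maximal_cogenerator E : finite E -> socle_mult_free E ->
  (forall N, finite N -> socle_mult_free N -> (mlen N <= mlen E)%N) ->
  cogenerator E.
Proof.
move=> fE sE maxE N W v fN hW Wv.
have [|Z [hZ WZ Zv maxZ]] := maximal_submodule hW Wv (P := fun T => ~ T v).
  by move=> F _ FP _ [T /FP Tv /Tv].
have [Q [q [qS qk]]] := quotient_exists hZ.
have fQ : finite Q by apply: finite_surj qS fN.
(* By maximality of [Z], every nonzero submodule of Q contains [q v]. *)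
have sv : simple_elt (q v).
  split=> [/qk//|r].
  have [rv|rv] := pselect (r *: q v = 0); [by left|right].
  apply: contrapT => nr'; apply: rv; rewrite -(linZ q); apply/qk.
  rewrite -(maxZ (sum_set Z (cyclic_set (r *: v)))).
  - by exists 0, (r *: v); split; [exact: submod0|exact: cyclic_self|rewrite add0r].
  - exact: submod_sum_set (submod_cyclic _).
  - move=> [z [_ [Zz [r' ->] E0]]]; apply: nr'; exists r'.
    by rewrite [in RHS]E0 linearD !(linZ q) ((qk z).2 Zz) add0r.
  move=> z Zz; exists z, 0; split=> //; last by rewrite addr0.
  by exists 0; rewrite scale0r.
have [[e [se ev]]|ne] := pselect (exists e : E, simple_elt e /\
    forall r, r *: e = 0 -> r *: q v = 0).
  (* The simple module R (q v) embeds in E at [e]. Amalgamate E and Q along it and pass to an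
     essential quotient E'. By maximality E -> E' is bijective, and its inverse extends the
     embedding to all of Q. *)
  have [P [p [pS pk]]] := quotient_exists (submod_cyclic ((e, - q v) : (E * Q)%type)).
  pose i := p \o lin_of (pair_linear idfun (\0 : {linear E -> Q})) : {linear E -> P}.
  have iI : injective i.
    apply: inj_ker => x /= /pk[r []] -> /eqP.
    rewrite scalerN eq_sym oppr_eq0 => /eqP.
    by apply: simple_elt_ann ev _ => //; case: sv.
  have [E' [t [tS tiI sE']]] := essential_quotient iI sE.
  have fP : finite P by apply: finite_surj pS (finite_prod fE fQ).
  have fE' : finite E' by apply: finite_surj tS fP.
  have tib : bijective (t \o i : {linear E -> E'}).
    exact: mlen_inj_bij tiI fE' (maxE _ fE' sE').
  have [h [hK Kh]] := lin_inv tib.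
  pose j := t \o (p \o lin_of (pair_linear (\0 : {linear N -> E}) q)) : {linear N -> E'}.
  exists (h \o j : {linear N -> E}); split=> [w Ww|] /=.
    by rewrite ((qk w).2 (WZ _ Ww)) !linear0.
  have -> : p (0, q v) = i e.
    apply/eqP; rewrite eq_sym -subr_eq0 /i /= -linearB; apply/eqP/pk; exists 1.
    by rewrite scale1r; congr (_, _); rewrite /= ?subr0 ?sub0r.
  by rewrite [h _]hK; case: se.
(* Now S = R (q v) does not occur in E, so E x S still has a multiplicity-free socle although it is
   longer than E. *)
exfalso.
have [S [j [jI jS]]] := submodule_exists (submod_cyclic (q v)).
have [s0 js0] := (jS (q v)).1 (cyclic_self _).
have annS (s : S) r : s <> 0 -> r *: s = 0 <-> r *: q v = 0.
  move=> sn0; have [b jb] : cyclic_set (q v) (j s) by apply/jS; exists s.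
  split=> [rs|rv]; last first.
    by apply: jI; rewrite (linZ j) jb scalerA mulrC -scalerA rv scaler0 linear0.
  case: (sv.2 b) => [bv|[b' bv]]; first by case: sn0; apply: (inj0 jI); rewrite jb.
  by rewrite -bv -jb scalerA mulrC -scalerA -(linZ j) rs linear0 scaler0.
have fS : finite S by apply: finite_inj jI fQ.
have soc : socle_mult_free (E * S)%type.
  move=> [e1 s1] [e2 s2] [n0 alt] a12.
  have [s10|s1n0] := pselect (s1 = 0).
    have e10 : e1 <> 0 by move=> e10; apply: n0; rewrite s10 e10.
    have se1 : simple_elt e1.
      split=> // r; case: (alt r) => [[]|[r' []]]; [by left|by right; exists r'].
    have s20 : s2 = 0.
      apply: contrapT => s2n0; apply: ne; exists e1; split=> // r re1.
      apply/(annS _ _ s2n0); suff /a12[] : r *: (e1, s1) = 0 by [].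
      by rewrite s10; congr (_, _); rewrite // scaler0.
    have [r re1|r ->] := sE e1 e2 se1.
      suff /a12[] : r *: (e1, s1) = 0 by [].
      by rewrite s10; congr (_, _); rewrite // scaler0.
    by exists r; rewrite s10 s20; congr (_, _); rewrite scaler0.
  have e10 : e1 = 0.
    apply: contrapT => e1n0; apply: ne; exists e1; split.
      split=> // r; case: (alt r) => [[]|[r' []]]; [by left|by right; exists r'].
    move=> r re1; apply/(annS _ _ s1n0).
    case: (alt r) => [[]//|[r' [E1 _]]].
    by exfalso; apply: e1n0; rewrite -E1 re1 scaler0.
  have e20 : e2 = 0.
    have ve2 r : r *: q v = 0 -> r *: e2 = 0.
      move=> /(annS _ _ s1n0) rs1; suff /a12[] : r *: (e1, s1) = 0 by [].
      by rewrite e10; congr (_, _); rewrite // scaler0.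
    apply: contrapT => e2n0; apply: ne; exists e2; split=> [|r].
      exact: simple_elt_of_ann ve2 e2n0.
    exact: simple_elt_ann ve2 e2n0.
  have [b1 jb1] : cyclic_set (q v) (j s1) by apply/jS; exists s1.
  have [b2 jb2] : cyclic_set (q v) (j s2) by apply/jS; exists s2.
  case: (sv.2 b1) => [bv|[b' bv]]; first by case: s1n0; apply: (inj0 jI); rewrite jb1.
  exists (b2 * b'); rewrite e10 e20; congr (_, _); first by rewrite scaler0.
  by apply: jI; rewrite (linZ j) jb1 jb2 -scalerA bv.
have fES := finite_prod fE fS.
have incI : injective (lin_of (pair_linear idfun (\0 : {linear E -> S}))).
  by move=> x y [].
have /bij_surj/(_ (0, s0))[x [_ s00]] := mlen_inj_bij incI fES (maxE _ fES soc).
by case: sv => qv0 _; apply: qv0; rewrite -js0 -s00 linear0.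
Qed.

(* The second property makes X reflexive for Hom_R(-, E), stated without a module
   structure on Hom_R(X, E). *)
Lemma dual_basis E X : socle_mult_free E -> cogenerator E -> finite X ->
  exists (n : nat) (xi : 'I_n -> {linear X -> E}),
  (forall eta : {linear X -> E}, exists c : 'I_n -> R,
     forall x, eta x = \sum_i c i *: xi i x) /\
  (forall e : 'I_n -> E,
     (forall c : 'I_n -> R, (forall x, \sum_i c i *: xi i x = 0) ->
        \sum_i c i *: e i = 0) ->
     exists x, forall i, xi i x = e i).
Proof.
(* Induction on the length of X: divide by a simple submodule R s, and add to the maps found for the
   quotient one map [xi0] with [xi0 s] nonzero. *)
move=> sE cE fX; have [n le] := ubnP (mlen X).
elim: n => // n IH in X fX le *.
have [X0|/existsNP/(simple_elt_exists fX)[s ss]] := pselect (forall x : X, x = 0).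
  exists 0%N, (fun _ => \0); split=> [eta|e _].
    by exists (fun _ => 0) => x; rewrite big_ord0 (X0 x) linear0.
  by exists 0 => -[].
have [Q [q [qS qk]]] := quotient_exists (submod_cyclic s).
have qs : q s = 0 by apply/qk/cyclic_self.
have fQ : finite Q by apply: finite_surj qS fX.
have [|m [xiQ [span eval]]] := IH Q fQ.
  suff : (mlen Q < mlen X)%N by move: le; rewrite ltnS => l1 l2; apply: leq_trans l2 l1.
  rewrite /mlen -(surj_image qS) (len_add q (submodT X) fX).
  suff : len (setT `&` ker q) <> 0%N by move=> /eqP; rewrite -lt0n => H; rewrite -[X in (X < _)%N]add0n ltn_add2r.
  move/len0P => H; case: ss => + _; apply; apply: H => //.
  - exact: submodI (submod_ker q).
  - exact: finS.
have [|xi0 [_ xi0s]] := cE X [set 0] s fX (submod_set0 X); first by case: ss.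
have sxi0 := simple_elt_map ss xi0s.
have ann r : r *: xi0 s = 0 -> r *: s = 0.
  by apply: simple_elt_ann xi0s => // t ts; rewrite -(linZ xi0) ts linear0.
have factor (eta : {linear X -> E}) : eta s = 0 ->
    exists c : 'I_m -> R, forall x, eta x = \sum_i c i *: xiQ i (q x).
  move=> es; have [|h hP] := lin_factor (f := eta) qS.
    by move=> x /qk[r ->]; rewrite (linZ eta) es scaler0.
  by have [c cP] := span h; exists c => x; rewrite -hP cP.
exists m.+1, (fun i => if unlift ord0 i is Some j then xiQ j \o q : {linear X -> E} else xi0).
split=> [eta|e eP].
  (* The simple type of s occurs only once in E, so [eta s] is a multiple of [xi0 s], and the
     difference factors through Q. *)
  have [r rs|r er] := sE (xi0 s) (eta s) sxi0; first by rewrite -(linZ eta) ann // linear0.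
  have dl : linear (fun x => eta x - r *: xi0 x).
    move=> a x y; rewrite (linearP eta) (linearP xi0) scalerDr opprD addrACA scalerBr !scalerA.
    by rewrite (mulrC r).
  have [|c cP] := factor (lin_of dl); first by rewrite /= er subrr.
  exists (fun i => if unlift ord0 i is Some j then c j else r) => x.
  rewrite big_ord_recl unlift_none; apply/eqP; rewrite addrC -subr_eq; apply/eqP.
  by rewrite [LHS]cP; apply: eq_bigr => i _; rewrite liftK.
have [c cP|x1b x1P] := eval (fun j => e (lift ord0 j)).
  have := eP (fun i => if unlift ord0 i is Some j then c j else 0).
  rewrite big_ord_recl unlift_none scale0r add0r => H.
  rewrite -[RHS]H => [|x]; first by apply: eq_bigr => i _; rewrite liftK.
  rewrite big_ord_recl unlift_none scale0r add0r -[RHS](cP (q x)).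
  by apply: eq_bigr => i _; rewrite liftK.
have [x1 qx1] := qS x1b.
(* Only the value at [xi0] can still be wrong. If r kills [xi0 s], then r xi0 factors through Q;
   this is a relation, which e satisfies, so r kills the defect. Hence adding a multiple of s
   corrects it. *)
have [r rs|r er] := sE (xi0 s) (e ord0 - xi0 x1) sxi0.
  have dl : linear (fun x => r *: xi0 x).
    by move=> a x y; rewrite (linearP xi0) scalerDr !scalerA (mulrC r).
  have [|c cP] := factor (lin_of dl); first by [].
  rewrite /= in cP.
  have := eP (fun i => if unlift ord0 i is Some j then - c j else r).
  rewrite big_ord_recl unlift_none scalerBr cP => H.
  rewrite -[RHS]H => [|x].
    congr (_ + _); rewrite -sumrN; apply: eq_bigr => i _.
    by rewrite liftK qx1 x1P scaleNr.
  rewrite big_ord_recl unlift_none cP -big_split big1 //= => i _.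
  by rewrite liftK scaleNr subrr.
exists (x1 + r *: s) => i; case: unliftP => [j ->|->] /=.
  by rewrite linearD (linZ q) qs scaler0 addr0 qx1 x1P.
by rewrite linearD (linZ xi0) -er addrCA subrr addr0.
Qed.

End Cogenerator.

(** * Chains of maps between indecomposable modules *)
Section Chains.
Variable A : pzRingType.
Implicit Types M N P : lmodType A.

Lemma indecomposable_split M (S T : set M) : indecomposable M ->
  is_submodule S -> is_submodule T -> (forall x, S x -> T x -> x = 0) ->
  (forall x, exists s t, [/\ S s, T t & x = s + t]) ->
  (forall x, S x -> x = 0) \/ (forall x, T x -> x = 0).
Proof.
move=> [_ indM] hS hT ST0 STs.
have [Y [i [iI iP]]] := submodule_exists hS.
have [Z [j [jI jP]]] := submodule_exists hT.
have fl : linear (fun z : (Y * Z)%type => i z.1 + j z.2).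
  by move=> a [y z] [y' z'] /=; rewrite !linearP scalerDr addrACA.
have [g [fK gK]] : exists g : {linear M -> (Y * Z)%type}, cancel (lin_of fl) g /\ cancel g (lin_of fl).
  apply: lin_inv; apply: bij_of.
    apply: inj_ker => -[y z] /= /eqP; rewrite addr_eq0 => /eqP E.
    have y0 : i y = 0.
      apply: ST0; first by apply/iP; exists y.
      by rewrite E; apply: submodN => //; apply/jP; exists z.
    rewrite (inj0 iI y0); congr (_, _); apply: (inj0 jI).
    by apply/eqP; rewrite -oppr_eq0 -E y0.
  move=> x; have [s [t [/iP[y <-] /jP[z <-] ->]]] := STs x; by exists (y, z).
have [|Y0|Z0] := indM Y Z; first by exists g, (lin_of fl).
- by left=> x /iP[y <-]; rewrite (Y0 y) linear0.
by right=> x /jP[z <-]; rewrite (Z0 z) linear0.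
Qed.

Section Comp.
Variables (X : nat -> lmodType A) (f : forall i, {linear X i -> X i.+1}).

Definition cast_lin i j (e : i = j) : {linear X i -> X j} :=
  match e in _ = k return {linear X i -> X k} with erefl => idfun end.

(* The composite X i -> X j of the chain for i <= j; the zero map for j < i. *)
Fixpoint seg i j : {linear X i -> X j} :=
  match eq_comparable i j with
  | left e => cast_lin e
  | right _ => match j return {linear X i -> X j} with
               | 0 => \0
               | k.+1 => f k \o seg i k
               end
  end.

Lemma cast_lin_id i (e : i = i) x : cast_lin e x = x.
Proof. by rewrite (eq_irrelevance e erefl). Qed.

Lemma seg_id i x : seg i i x = x.
Proof.
case: i x => [|i] x /=; first exact: cast_lin_id.
by case: (eq_comparable i.+1 i.+1) => [e|/(_ erefl)//]; exact: cast_lin_id.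
Qed.

Lemma segS i j x : (i <= j)%N -> seg i j.+1 x = f j (seg i j x).
Proof. by move=> ij /=; case: (eq_comparable i j.+1) => // e; exfalso; move: ij; rewrite e ltnn. Qed.

Lemma seg_trans i j k x : (i <= j <= k)%N -> seg i k x = seg j k (seg i j x).
Proof.
elim: k => [|k IH] /andP[ij jk].
  have j0 : j = 0%N by lia.
  by subst j; rewrite seg_id.
have [E|jk'] := eqVneq j k.+1; first by subst j; rewrite seg_id.
rewrite segS ?segS ?IH //; lia.
Qed.

(* For a < b < c such that X a -> X b, X b -> X c and X a -> X c have images of the
   same length, X b is the direct sum of the image of the first map and of the
   kernel of the second one. *)
Lemma harada_sai (N : nat) :
  (forall i, indecomposable (X i)) -> (forall i, finite (X i)) ->
  (forall i, mlen (X i) <= N)%N -> (forall n, exists x, seg 0 n x <> 0) ->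
  exists i, injective (f i).
Proof.
move=> indX fX lX nz.
pose r i j := len (seg i j @` setT).
have r_le i j : (r i j <= N)%N.
  exact: leq_trans (mlen_le _ (fX j)) (lX j).
have r_pos i j : (i <= j)%N -> (0 < r i j)%N.
  move=> ij; have [x] := nz j; rewrite (@seg_trans 0 i j) ?ij // => H.
  rewrite lt0n; apply/eqP => /len0P E; apply: H; apply: E.
  - exact: submod_image.
  - exact: finS.
  by exists (seg 0 i x).
have r_anti i j k : (i <= j <= k)%N -> (r i k <= r i j)%N.
  move=> ijk; rewrite /r (_ : seg i k @` _ = seg j k @` (seg i j @` setT)).
    by apply: len_image_le; [exact: submod_image|exact: finS].
  apply/seteqP; split=> [_ [x _ <-]|_ [_ [x _ <-] <-]].
    by exists (seg i j x); [exists x|rewrite (@seg_trans i j k)].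
  by exists x => //; rewrite (@seg_trans i j k).
have r_mono i j k : (i <= j <= k)%N -> (r i k <= r j k)%N.
  move=> ijk; apply: len_le; last exact: finS.
  by move=> _ [x _ <-]; exists (seg i j x) => //; rewrite (@seg_trans i j k).
(* For fixed i the length [r i j] decreases to a limit as j grows. Here n will be the largest of
   these limits and a an index where it is attained; from every i some j brings [r i j] down to at
   most n. *)
pose p n := `[< exists i, forall j, (i <= j)%N -> (n <= r i j)%N >].
have p0 : exists n, p n by exists 0%N; apply/asboolP; exists 0%N.
have pN n : p n -> (n <= N)%N.
  by move=> /asboolP[i /(_ i (leqnn i)) H]; apply: leq_trans H (r_le _ _).
case: (ex_maxnP p0 pN) => n /asboolP[a aP] nmax.
have attain i : exists j, (i <= j)%N /\ (r i j <= n)%N.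
  apply: contrapT => H; suff /nmax : p n.+1 by rewrite ltnn.
  apply/asboolP; exists i => j ij; rewrite ltnNge; apply/negP => jn.
  by apply: H; exists j.
have [b [ab rab]] := attain a.
(* The successor ensures b < c, so that the composite X b -> X c begins with [f b]. *)
have [c0 [bc0 rbc0]] := attain b; pose c := c0.+1.
have bc : (b < c)%N by [].
have rac : (n <= r a c)%N by apply: aP; lia.
have rbc : (r b c <= n)%N by apply: leq_trans rbc0; apply: r_anti; lia.
pose S := seg a b @` setT; pose g := seg b c.
have hS : is_submodule S by apply: submod_image.
have gS : g @` S = seg a c @` setT.
  apply/seteqP; split=> [_ [_ [x _ <-] <-]|_ [x _ <-]].
    by exists x => //; rewrite (@seg_trans a b c) //; lia.
  by exists (seg a b x); [exists x|rewrite (@seg_trans a b c) //; lia].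
have gST : g @` S = g @` setT.
  apply: len_eq; [exact: submod_image|by move=> _ [x _ <-]; exists x|exact: finS|].
  by rewrite gS; apply: leq_trans rac.
have Sk0 : len (S `&` ker g) = 0%N.
  have E := len_add g hS (finS S (fX b)); rewrite gS in E.
  by apply/eqP; rewrite -leqn0 -(leq_add2r (r a c)) -E; apply: leq_trans rab rac.
have [|x|S0|k0] := indecomposable_split (indX b) hS (submod_ker g).
- move=> x Sx kx; have /len0P := Sk0; apply=> //; last exact: finS.
  exact: submodI (submod_ker g).
- have [s Ss gs] : (g @` S) (g x) by rewrite gST; exists x.
  exists s, (x - s); split=> //; last by rewrite addrC subrK.
  by rewrite /ker /= linearB gs subrr.
- have h0 : len S = 0%N by apply/len0P => //; exact: finS.
  by have := r_pos a b ab; rewrite /r -/S h0.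
exists b => x y fxy; have gI : injective g by apply: inj_ker => z; apply: k0.
apply: gI; rewrite /g !(@seg_trans b b.+1 c) ?leqnSn //.
by rewrite !(segS _ (leqnn b)) !seg_id fxy.
Qed.

End Comp.

(** Harada-Sai for the constant chain with all maps equal to [t]. *)
Lemma fitting M (t : {linear M -> M}) : indecomposable M -> finite M ->
  injective t \/ exists n, forall x, iter n t x = 0.
Proof.
move=> indM fM.
have [[n nP]|H] := pselect (exists n, forall x, iter n t x = 0); first by right; exists n.
left; have [|_ //] := @harada_sai (fun _ => M) (fun _ => t) (mlen M) (fun _ => indM) (fun _ => fM) (fun _ => leqnn _).
move=> n; have [x xP] : exists x, iter n t x <> 0.
  by apply/existsNP => nP; apply: H; exists n.
exists x; suff -> : seg (fun _ => t) 0 n x = iter n t x by [].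
by elim: n {xP} => [|n IH]; [exact: (seg_id (X := fun=> M))|rewrite segS // IH].
Qed.

(** With s inverse to t1 + t2, the map s t1 is not injective, hence nilpotent; but it fixes the
    kernel of t2, so t2 would be injective. *)
Lemma indecomposable_local M (t1 t2 : {linear M -> M}) : indecomposable M -> finite M ->
  ~ injective t1 -> ~ injective t2 -> ~ injective (t1 \+ t2 : {linear M -> M}).
Proof.
move=> indM fM n1 n2 sI.
have [s [_ Ks]] := lin_inv (mlen_inj_bij sI fM (leqnn _)).
have [pI|[n nP]] := fitting (s \o t1 : {linear M -> M}) indM fM.
  by apply: n1 => x y xy; apply: pI; rewrite /= xy.
apply: n2; apply: inj_ker => x t2x.
have px : s (t1 x) = x.
  by apply: sI; rewrite Ks /= t2x addr0.
rewrite -[x](_ : iter n (s \o t1) x = x) //.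
by elim: n {nP} => //= n ->.
Qed.

Definition split_mono M N (u : {linear M -> N}) :=
  exists v : {linear N -> M}, cancel u v.

End Chains.

(** * Left almost split maps *)
Section Restriction.
Variables (R : comNzRingType) (L : algType R).

Definition res (X : lmodType L) : Type := X.
HB.instance Definition _ X := GRing.Zmodule.copy (res X) X.

Section Res.
Variable X : lmodType L.
Definition res_scale (r : R) (x : res X) : res X := (r%:A : L) *: (x : X).

Lemma res_scaleA a b x : res_scale a (res_scale b x) = res_scale (a * b) x.
Proof. by rewrite /res_scale scalerA -scalerAl mul1r scalerA. Qed.
Lemma res_scale1 : left_id 1 res_scale.
Proof. by move=> x; rewrite /res_scale scale1r scale1r. Qed.
Lemma res_scaleDr : right_distributive res_scale +%R.
Proof. by move=> a x y; rewrite /res_scale scalerDr. Qed.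
Lemma res_scaleDl x : {morph res_scale^~ x : a b / a + b}.
Proof. by move=> a b; rewrite /res_scale !scalerDl. Qed.

HB.instance Definition _ := GRing.Zmodule_isLmodule.Build R (res X)
  res_scaleA res_scale1 res_scaleDr res_scaleDl.
End Res.

Lemma res_scaleE (X : lmodType L) (r : R) (x : res X) : r *: x = (r%:A : L) *: (x : X).
Proof. by []. Qed.

Lemma submod_res (X : lmodType L) (S : set X) :
  is_submodule S -> is_submodule (S : set (res X)).
Proof. by case=> S0 hS; split=> // a x y; apply: hS. Qed.

Lemma finite_res (X : lmodType L) : finite (res X) -> finite X.
Proof.
suff H n (S : set X) : lge S n -> lge (S : set (res X)) n by case=> n nX; exists n => /H.
elim: n S => //= n IH S [T [hT TS xT /IH Tn]]; exists T; split=> //.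
exact: submod_res.
Qed.

Lemma scale_res_linear (X : lmodType L) (v : X) : linear ((fun l => l *: v) : L -> res X).
Proof. by move=> r l l'; rewrite scalerDl res_scaleE scalerA mulr_algl. Qed.

Lemma lscale_res_linear (X : lmodType L) (a : L) : linear ((fun x => a *: x) : res X -> res X).
Proof.
by move=> r x y; rewrite !res_scaleE scalerDr !scalerA mulr_algr mulr_algl.
Qed.

Hypothesis artL : artin_algebra L.

Lemma finite_alg : finite L.
Proof. by case: artL => /artinian_finite fR /(finitely_generated_finite fR). Qed.

Lemma finite_res_fg (X : lmodType L) : finitely_generated X -> finite (res X).
Proof.
move=> [n [v vP]].
exact: (finite_span (f := fun i => lin_of (scale_res_linear (v i))) finite_alg).
Qed.

Lemma finite_fg (X : lmodType L) : finitely_generated X -> finite X.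
Proof. by move=> /finite_res_fg/finite_res. Qed.

Lemma fg_regular : finitely_generated (L^o : lmodType L).
Proof. by exists 1%N, (fun _ => 1) => x; exists (fun _ => x); rewrite big_ord1 [RHS]mulr1. Qed.

End Restriction.

Section AlmostSplit.
Variables (R : comNzRingType) (L : algType R).
Hypothesis artL : artin_algebra L.

Lemma single_linear (A : pzRingType) (M : lmodType A) (I : finType) (i : I) :
  linear (fun x : M => [ffun j => if j == i then x else 0]).
Proof.
by move=> a x y; apply/ffunP => j; rewrite !ffunE; case: eqP => _; rewrite ?scaler0 ?addr0.
Qed.

Lemma linear_ffunE (A : pzRingType) (M N : lmodType A) (I : finType)
    (th : {linear {ffun I -> M} -> N}) z :
  th z = \sum_i (th \o lin_of (@single_linear _ M _ i)) (z i).
Proof.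
rewrite -[RHS](linear_sum th); congr (th _).
apply/ffunP => j; rewrite sum_ffunE (bigD1 j) //= ffunE eqxx big1 ?addr0 // => i ij.
by rewrite ffunE eq_sym (negPf ij).
Qed.

(* The functional t |-> sum_k xi k (t (x' k)) on End X vanishes on the radical but
   not at the identity.  It is the element sum_k xi k (x) x' k of the tensor product of
   Hom_R(X, E) and X over L, and by duality it kills t \o h for all t : M -> X iff
   sum_k xi k (x) h (x' k) = 0, that is, iff h extends to the pushout Y of X that solves
   the relations g j between the xi k in terms of x'. *)
Lemma left_almost_split (X : lmodType L) :
  finitely_generated X -> indecomposable X ->
  exists (Y : lmodType L) (u : {linear X -> Y}),
    [/\ finitely_generated Y, ~ split_mono u &
      forall (M : lmodType L) (h : {linear X -> M}), finitely_generated M ->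
        ~ split_mono h -> exists h' : {linear Y -> M}, forall x, h x = h' (u x)].
Proof.
move=> fgX indX.
have fR : finite R^o by apply: artinian_finite; case: artL.
have [E [fE sE maxE]] := maximal_socle_mult_free fR.
have cE := maximal_cogenerator fE sE maxE.
have frX := finite_res_fg artL fgX; have fX := finite_fg artL fgX.
have [n [xi [span eval]]] := dual_basis sE cE frX.
have [m [v vP]] := fgX.
have vext (t : {linear X -> X}) : (forall j, t (v j) = v j) -> forall x, t x = x.
  move=> tv x; have [c ->] := vP x; rewrite linear_sum; apply: eq_bigr => j _.
  by rewrite (linZ t) tv.
(* The radical of End X, encoded by values on the generators [v j]. The noninjective maps are closed
   under sums because End X is local. *)
pose V : set {ffun 'I_m -> res X} :=
  [set z | exists2 t : {linear X -> X}, ~ injective t & forall j, z j = t (v j)].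
have hV : is_submodule V.
  split.
    exists \0; last by move=> j; rewrite ffunE.
    case: (indX) => nz _ inj0; apply: nz => x; exact: inj0.
  move=> a x y [t1 n1 xt] [t2 n2 yt].
  have al : linear (fun x : X => (a%:A : L) *: t1 x).
    by move=> b x' y'; rewrite linearP scalerDr !scalerA mulr_algl mulr_algr.
  exists (lin_of al \+ t2) => [|j]; last by rewrite !ffunE xt yt.
  apply: indecomposable_local => // aI; apply: n1 => x' y' xy.
  by apply: aI; rewrite /= xy.
have Vv : ~ V [ffun j => v j : res X].
  move=> [t nt tv]; apply: nt => x y; rewrite !vext // => j; by rewrite -tv ffunE.
have [th [thV thv]] := cE _ V _ (finite_ffun _ frX) hV Vv.
have /choice[c cP] j := span (th \o lin_of (@single_linear _ (res X) _ j) : {linear res X -> E}).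
(* The coefficients of the components of [th] in terms of the [xi k] are collected in [x']. *)
pose x' k : X := \sum_j c j k *: (v j : res X).
have xiE (t : {linear X -> X}) : \sum_k xi k (t (x' k)) = th [ffun j => t (v j) : res X].
  rewrite linear_ffunE (eq_bigr _ (fun j _ => cP j _)) exchange_big /=.
  apply: eq_bigr => k _.
  have -> : t (x' k) = \sum_j c j k *: (t (v j) : res X).
    rewrite [t _](linear_sum t); apply: eq_bigr => j _; exact: linZ.
  by rewrite linear_sum; apply: eq_bigr => j _; rewrite (linZ (xi k)) ffunE.
have xi_id : \sum_k xi k (x' k) <> 0 by rewrite (xiE idfun).
have xi_rad (t : {linear X -> X}) : ~ injective t -> \sum_k xi k (t (x' k)) = 0.
  by move=> nt; rewrite xiE; apply: thV; exists t => // j; rewrite ffunE.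
pose Rel : set {ffun 'I_n -> L} :=
  [set l | forall x : X, \sum_k xi k (l k *: x : X) = 0].
have hRel : is_submodule Rel.
  split=> [x|a l l' Rl Rl' x]; first by rewrite big1 // => k _; rewrite ffunE scale0r linear0.
  transitivity (a *: (\sum_k xi k (l k *: x : X)) + \sum_k xi k (l' k *: x : X)).
    rewrite scaler_sumr -big_split; apply: eq_bigr => k _.
    rewrite !ffunE -[RHS](linearP (xi k)); congr (xi k _).
    by rewrite scalerDl res_scaleE scalerA mulr_algl.
  by rewrite Rl Rl' scaler0 addr0.
have [p [g [gR gP]]] := fin_len_gens hRel (finS Rel (finite_ffun _ (finite_alg artL))).
pose rel (a : 'I_n -> L) : (X * {ffun 'I_p -> L^o})%type :=
  (\sum_k a k *: x' k, [ffun j => - \sum_k a k * g j k]).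
pose D : set (X * {ffun 'I_p -> L^o})%type := [set z | exists a, z = rel a].
have hD : is_submodule D.
  split.
    exists (fun _ => 0); congr (_, _); first by rewrite big1 // => k _; rewrite scale0r.
    by apply/ffunP => j; rewrite !ffunE big1 ?oppr0 // => k _; rewrite mul0r.
  move=> b _ _ [a ->] [a' ->]; exists (fun k => b * a k + a' k); congr (_, _).
    rewrite /= scaler_sumr -big_split; apply: eq_bigr => k _.
    by rewrite scalerDl scalerA.
  apply/ffunP => j; rewrite !ffunE scalerN -opprD; congr (- _).
  rewrite [_ *: _]mulr_sumr -big_split; apply: eq_bigr => k _.
  by rewrite mulrDl mulrA.
have [Y [q [qS qk]]] := quotient_exists hD.
have fL : finite L^o := finite_fg artL (fg_regular L).
pose u := q \o lin_of (pair_linear idfun (\0 : {linear X -> {ffun 'I_p -> L^o}})) : {linear X -> Y}.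
have usolve (M : lmodType L) (h : {linear X -> M}) (y : 'I_p -> M) :
    (forall k, h (x' k) = \sum_j g j k *: y j) ->
    exists h' : {linear Y -> M}, forall x, h x = h' (u x).
  move=> hy.
  have Hl : linear (fun z : (X * {ffun 'I_p -> L^o})%type => h z.1 + \sum_j (z.2 j : L) *: y j).
    move=> b [x w] [x1 w1] /=; rewrite linearP scalerDr addrACA; congr (_ + _).
    rewrite scaler_sumr -big_split; apply: eq_bigr => j _.
    by rewrite !ffunE scalerDl scalerA.
  have [z /qk[a ->]|h' h'P] := lin_factor (f := lin_of Hl) qS.
    rewrite /= linear_sum.
    have -> : \sum_k h (a k *: x' k) = \sum_j (\sum_k a k * g j k) *: y j.
      under [RHS]eq_bigr do rewrite scaler_suml.
      rewrite exchange_big; apply: eq_bigr => k _; rewrite (linZ h) hy scaler_sumr.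
      by apply: eq_bigr => j _; rewrite scalerA.
    rewrite -big_split big1 //= => j _.
    by rewrite ffunE scaleNr subrr.
  exists h' => x; rewrite /u /= h'P /= big1 ?addr0 // => j _.
  by rewrite ffunE scale0r.
exists Y, u; split.
- apply/finite_finitely_generated/(finite_surj qS).
  exact: finite_prod (finite_ffun _ fL).
(* A retraction would solve the equations in X itself. As each [g j] lies in [Rel], the functional
   would then vanish at the identity. *)
- move=> [r rK]; apply: xi_id.
  pose y j : X := r (q (0, [ffun i => if i == j then 1 else 0])).
  have xy k : x' k = \sum_j g j k *: y j.
    pose H := r \o (q \o lin_of (pair_linear (\0 : {linear {ffun 'I_p -> L^o} -> X}) idfun)) : {linear {ffun 'I_p -> L^o} -> X}.
    rewrite -[LHS]rK.
    have -> : u (x' k) = q (0, [ffun j => g j k]).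
      apply/eqP; rewrite -subr_eq0 /u /= -linearB; apply/eqP/qk.
      exists (fun i => if i == k then 1 else 0); congr (_, _) => /=.
        rewrite (bigD1 k) //= eqxx scale1r big1 ?addr0 ?subr0 // => i /negPf->.
        by rewrite scale0r.
      apply/ffunP => j; rewrite !ffunE sub0r; congr (- _).
      by rewrite (bigD1 k) //= eqxx mul1r big1 ?addr0 // => i /negPf->; rewrite mul0r.
    rewrite -[LHS]/(H [ffun j => g j k]) linear_ffunE; apply: eq_bigr => j _.
    rewrite ffunE /= /y -(linZ r) -(linZ q); congr (r (q (_, _))).
      by rewrite scaler0.
    by apply/ffunP => i; rewrite !ffunE; case: eqP => _; rewrite ?scaler0 // [RHS]mulr1.
  under eq_bigr => k _ do rewrite xy linear_sum.
  by rewrite exchange_big big1 //= => j _; apply: gR.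
move=> M h fgM nh.
have frM := finite_res_fg artL fgM.
(* The systems solvable in M. If that of h is not one of them, a map [ta] into E separates it from
   [W]. The components of [ta] satisfy every relation in [Rel], so by reflexivity they have the form
   xi k \o t for a map t : M -> X. *)
pose W : set {ffun 'I_n -> res M} :=
  [set w | exists y : 'I_p -> M, forall k, w k = \sum_j g j k *: y j].
have hW : is_submodule W.
  split.
    exists (fun _ => 0) => k; rewrite ffunE big1 // => j _; exact: scaler0.
  move=> a w w' [y wy] [y' wy'].
  exists (fun j => (a *: (y j : res M) : M) + y' j) => k.
  rewrite !ffunE wy wy' res_scaleE scaler_sumr -big_split; apply: eq_bigr => j _ /=.
  by rewrite scalerDr res_scaleE !scalerA mulr_algl mulr_algr.
have [[y hy]|nW] := pselect (W [ffun k => h (x' k) : res M]).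
  by apply: (usolve _ _ y) => k; rewrite -hy ffunE.
exfalso.
have [ta [taW ta0]] := cE _ W _ (finite_ffun _ frM) hW nW.
pose tk k : {linear res M -> E} := ta \o lin_of (@single_linear _ (res M) _ k).
have taE w : ta w = \sum_k tk k (w k) by exact: linear_ffunE.
have tRel l y : Rel l -> \sum_k tk k (l k *: (y : M) : M) = 0.
  move=> /gP[d ld].
  rewrite -[RHS](taW [ffun k => l k *: (y : M) : res M]).
    by rewrite taE; apply: eq_bigr => k _; rewrite ffunE.
  exists (fun j => d j *: (y : res M)) => k; rewrite ffunE ld sum_ffunE scaler_suml.
  by apply: eq_bigr => j _; rewrite ffunE res_scaleE scalerA mulr_algr.
have /choice[t tP] (y : M) : exists x : X, forall k, xi k x = tk k y.
  apply: (eval (fun k => tk k y)) => d dP.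
  have := @tRel [ffun k => (d k)%:A] y _; rewrite (_ : \sum_k _ = \sum_k d k *: tk k y).
    apply=> x; rewrite -[RHS](dP x); apply: eq_bigr => k _.
    by rewrite ffunE -(linZ (xi k)).
  by apply: eq_bigr => k _; rewrite ffunE -(linZ (tk k)).
have sep (x y : X) : (forall k, xi k x = xi k y) -> x = y.
  move=> xy; apply: contrapT => nxy.
  have [|e [_ e0]] := cE (res X) [set 0] (x - y) frX (submod_set0 _).
    by move=> /eqP; rewrite subr_eq0 => /eqP.
  apply: e0; have [d ->] := span e; rewrite big1 // => k _.
  by rewrite linearB xy subrr scaler0.
have tl : linear t.
  move=> a y z; apply: sep => k; rewrite tP.
  have [d dP] := span (xi k \o lin_of (@lscale_res_linear _ _ X a) : {linear res X -> E}).
  have ext (M' : lmodType L) (s : 'I_n -> {linear res M' -> E}) (y' : M') :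
      \sum_i s i ([ffun i => (if i == k then a else 0) - (d i)%:A] i *: y' : M')
      = s k (a *: y' : M') - \sum_i d i *: s i y'.
    rewrite -sumrN (bigD1 k) //= (bigD1 k (P := predT)) //= addrA; congr (_ + _).
      by rewrite ffunE eqxx scalerBl linearB -(linZ (s k)).
    apply: eq_bigr => i /negPf ik.
    by rewrite ffunE ik sub0r scaleNr linearN -(linZ (s i)).
  (* This encodes xi k (a x) = sum_i d i xi i (x). Transferring it to the components of [ta] makes t
     linear over L. *)
  have dRel : Rel [ffun i => (if i == k then a else 0) - (d i)%:A].
    by move=> x; rewrite ext -dP /= subrr.
  have := tRel _ y dRel; rewrite ext => /eqP; rewrite subr_eq0 => /eqP E1.
  rewrite [LHS]linearD E1 [RHS]linearD tP; congr (_ + _).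
  rewrite [RHS](dP (t y)).
  by apply: eq_bigr => i _; rewrite tP.
(* The value of [ta] is the functional at the endomorphism t h. It is 0 because an injective t h
   would be bijective and would split h. *)
apply: ta0; rewrite taE.
rewrite -[RHS](xi_rad (lin_of tl \o h : {linear X -> X})) => [|I].
  by apply: eq_bigr => k _; rewrite ffunE /= tP.
have [s [sK Ks]] := lin_inv (mlen_inj_bij I fX (leqnn _)).
by apply: nh; exists (s \o lin_of tl : {linear M -> X}) => x; rewrite -[RHS]sK.
Qed.

End AlmostSplit.

(** * Functors on the subcategory *)
Section Functors.
Variables (A : pzRingType) (C : lmodType A -> Prop).
Hypotheses (finC : forall X, C X -> finite X) (sumC : summand_closed C).

Lemma cm_map0 (F : cmodule C) (X Y : cobj C) (x : F X) (f : {linear X -> Y}) :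
  (forall z, f z = 0) -> cm_map F f x = 0.
Proof.
move=> f0; have E : f = f \+ f by apply: linear_eqP => z /=; rewrite f0 addr0.
apply: (@addrI _ (cm_map F f x)).
by rewrite addr0 -cm_map_add -E.
Qed.

Lemma cm_mapE (F : cmodule C) (X Y : cobj C) (x : F X) (f g : {linear X -> Y}) :
  f =1 g -> cm_map F f x = cm_map F g x.
Proof. by move=> /linear_eqP ->. Qed.

Lemma isomorphic_swap (X Y Z : lmodType A) :
  isomorphic X (Y * Z)%type -> isomorphic X (Z * Y)%type.
Proof.
move=> [f [g fK gK]]; have fl : linear (fun x => ((f x).2, (f x).1)).
  by move=> a x y; rewrite !linearP.
exists (lin_of fl), (fun z => g (z.2, z.1)) => [x|[z y]] /=; last by rewrite gK.
by rewrite -surjective_pairing fK.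
Qed.

(** Induction on the length: if X decomposes, x is the sum of its parts in two shorter summands, and
    one part is nonzero. *)
Lemma nonzero_component (F : cmodule C) (X : cobj C) (x : F X) : x <> 0 ->
  exists (M : cobj C) (p : {linear X -> M}),
    [/\ indecomposable M, forall y, exists z, p z = y & cm_map F p x <> 0].
Proof.
have [n le] := ubnP (mlen X); elim: n => // n IH in X x le * => x0.
have [iX|nX] := pselect (indecomposable X).
  by exists X, idfun; split=> // [y|]; [exists y|rewrite cm_map_id].
have nzX : ~ is_zero X.
  by move=> X0; apply: x0; rewrite -(cm_map_id x); apply: cm_map0 => z; exact: X0.
have [Y [Z [XYZ Y0 Z0]]] : exists Y Z : lmodType A, [/\ isomorphic X (Y * Z)%type, ~ is_zero Y & ~ is_zero Z].
  apply: contrapT => H; apply: nX; split=> // Y Z XYZ.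
  apply: contrapT => /not_orP[Y0 Z0]; apply: H; by exists Y, Z.
pose oY := CObj (sumC (cobjP X) XYZ).
pose oZ := CObj (sumC (cobjP X) (isomorphic_swap XYZ)).
have [f fb] := XYZ; have [g [fK gK]] := lin_inv fb.
pose pY := fst \o f : {linear X -> oY}; pose pZ := snd \o f : {linear X -> oZ}.
pose iY := g \o lin_of (pair_linear idfun (\0 : {linear Y -> Z})) : {linear oY -> X}.
pose iZ := g \o lin_of (pair_linear (\0 : {linear Z -> Y}) idfun) : {linear oZ -> X}.
have iYI : injective iY by move=> y y' /= /(can_inj gK)[].
have iZI : injective iZ by move=> y y' /= /(can_inj gK)[].
have fX : finite X by apply: finC; exact: cobjP.
have lY : (mlen Y < n)%N.
  rewrite ltnS in le; apply: leq_trans le; rewrite ltnNge; apply/negP => /(mlen_inj_bij iYI fX)/bij_surj s.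
  apply: Z0 => z; have [y yz] := s (g (0, z)).
  by move: yz => /(can_inj gK) [].
have lZ : (mlen Z < n)%N.
  rewrite ltnS in le; apply: leq_trans le; rewrite ltnNge; apply/negP => /(mlen_inj_bij iZI fX)/bij_surj s.
  apply: Y0 => y; have [z yz] := s (g (y, 0)).
  by move: yz => /(can_inj gK) [].
have xE : x = cm_map F iY (cm_map F pY x) + cm_map F iZ (cm_map F pZ x).
  rewrite -!cm_map_comp -cm_map_add -[LHS](cm_map_id x); apply: cm_mapE => z.
  rewrite /= -linearD -[LHS]fK [f z]surjective_pairing; congr (g (_, _)) => /=.
    by rewrite addr0.
  by rewrite add0r.
have [y0|y0] := pselect (cm_map F pY x = 0); last first.
  have [M [p [iM pS pn]]] := IH oY _ lY y0.
  exists M, (p \o pY : {linear X -> M}); split=> // [m|]; last by rewrite cm_map_comp.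
  by have [y <-] := pS m; exists (g (y, 0)); rewrite /= gK.
have z0 : cm_map F pZ x <> 0.
  by move=> z0; apply: x0; rewrite xE y0 z0 !raddf0 addr0.
have [M [p [iM pS pn]]] := IH oZ _ lZ z0.
exists M, (p \o pZ : {linear X -> M}); split=> // [m|]; last by rewrite cm_map_comp.
by have [y <-] := pS m; exists (g (0, y)); rewrite /= gK.
Qed.

Lemma finite_type_bounded : finite_representation_type C ->
  exists N, forall X, C X -> indecomposable X -> (mlen X <= N)%N.
Proof.
move=> [n [M MP]]; exists (\max_i mlen (M i)) => X CX iX.
have [i XM] := MP X CX iX; apply: leq_trans (leq_bigmax i).
have [f fb] := XM; rewrite (mlen_iso XM) //.
exact: finite_surj (bij_surj fb) (finC CX).
Qed.

Lemma finite_type_noetherian : finite_representation_type C ->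
  forall (J : Type) (phi : J -> arrow C),
    (forall j, [/\ indecomposable (arrow_src (phi j)),
                   indecomposable (arrow_tgt (phi j))
                 & injective (phi j)]) ->
    noetherian_family phi.
Proof.
move=> /finite_type_bounded[N NP] J phi phiP X f j jP _.
have H i : indecomposable (X i) /\ injective (f i).
  by have [] := phiP (j i); rewrite jP.
have fX i : finite (X i) by apply: finC; exact: cobjP.
pose p n := `[< exists i, n = mlen (X i) >].
have p0 : exists n, p n by exists (mlen (X 0%N)); apply/asboolP; exists 0%N.
have pN n : p n -> (n <= N)%N.
  by move=> /asboolP[i ->]; apply: NP (H i).1; exact: cobjP.
case: (ex_maxnP p0 pN) => n /asboolP[d dn] nmax; exists d => k dk.
have mono i : (mlen (X i) <= mlen (X i.+1))%N by apply: mlen_inj (H i).2 _.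
have dle : (n <= mlen (X k))%N.
  rewrite dn; elim: k dk => [|k IH]; first by rewrite leqn0 => /eqP ->.
  rewrite leq_eqVlt ltnS => /orP[/eqP ->//|/IH le].
  exact: leq_trans le (mono k).
apply: mlen_inj_bij (H k).2 (fX _) _; apply: leq_trans dle.
by apply: nmax; apply/asboolP; exists k.+1.
Qed.

(** Otherwise noninjective maps that keep x nonzero, followed by projections to indecomposables,
    form an infinite chain that contradicts Harada-Sai. *)
Lemma finite_type_strongly_minimal : finite_representation_type C ->
  forall (F : cmodule C) (X : cobj C) (x : F X), x <> 0 ->
    exists (X' : cobj C) (f : {linear X -> X'}), strongly_minimal (cm_map F f x).
Proof.
move=> /finite_type_bounded[N NP] F X x x0; apply: contrapT => nosm.
pose T := {M : cobj C & {linear X -> M}}.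
pose P (s : T) := indecomposable (projT1 s) /\ cm_map F (projT2 s) x <> 0.
have step (s : {s : T | P s}) : exists (t : {s : T | P s})
    (g : {linear projT1 (sval s) -> projT1 (sval t)}),
    ~ injective g /\ forall z, projT2 (sval t) z = g (projT2 (sval s) z).
  case: s => -[M f] /= [iM fx0].
  have [Y [g [gI gx0]]] : exists (Y : cobj C) (g : {linear M -> Y}),
      ~ injective g /\ cm_map F g (cm_map F f x) <> 0.
    apply: contrapT => H; apply: nosm; exists M, f; split=> // Y g gI.
    by apply: contrapT => gx0; apply: H; exists Y, g.
  have [M' [p [iM' _ px0]]] := nonzero_component gx0.
  have Pt : P (existT _ M' (p \o (g \o f) : {linear X -> M'})).
    by split=> //=; rewrite cm_map_comp cm_map_comp.
  exists (exist _ _ Pt), (p \o g : {linear M -> M'}); split=> // pgI.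
  by apply: gI => y z yz; apply: pgI; rewrite /= yz.
have /choice[next nextP] := step.
have [M0 [p0 [iM0 _ px0]]] := nonzero_component x0.
have P0 : P (existT _ M0 p0) by [].
pose s n := iter n next (exist _ _ P0).
pose f n := sval (cid (nextP (s n))).
have fP n := svalP (cid (nextP (s n))).
have [||||i fI] := @harada_sai A (fun n => projT1 (sval (s n))) f N.
- by move=> n; case: (svalP (s n)).
- by move=> n; apply: finC; exact: cobjP.
- by move=> n; apply: NP; [exact: cobjP|case: (svalP (s n))].
- move=> n; apply: contrapT => H.
  case: (svalP (s n)) => _; apply; apply: cm_map0 => z.
  have -> : projT2 (sval (s n)) z = seg f 0 n (projT2 (sval (s 0%N)) z).
    elim: n {H} => [|n IH]; first by rewrite (seg_id f).
    by rewrite segS // -IH; case: (fP n).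
  by apply: contrapT => H'; apply: H; exists (projT2 (sval (s 0%N)) z).
by case: (fP i) => + _; apply.
Qed.

(** * Elements killed by all maps that are not split monomorphisms *)

Section Minimal.
Hypothesis sm : forall (F : cmodule C) (X : cobj C) (x : F X), x <> 0 ->
  exists (X' : cobj C) (f : {linear X -> X'}), strongly_minimal (cm_map F f x).
Hypothesis noeth : forall (J : Type) (phi : J -> arrow C),
  (forall j, [/\ indecomposable (arrow_src (phi j)),
                 indecomposable (arrow_tgt (phi j))
               & injective (phi j)]) -> noetherian_family phi.

(** A surjection p that keeps the element nonzero preserves strong minimality, since g is injective
    whenever g p is. *)
Lemma strongly_minimal_indecomposable (F : cmodule C) (X : cobj C) (x : F X) : x <> 0 ->
  exists (M : cobj C) (f : {linear X -> M}),
    indecomposable M /\ strongly_minimal (cm_map F f x).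
Proof.
move=> /sm[Y [f [y0 yP]]]; have [M [p [iM pS py0]]] := nonzero_component y0.
exists M, (p \o f : {linear X -> M}); split=> //; rewrite cm_map_comp; split=> // Z g gI.
rewrite -cm_map_comp; apply: yP => gpI; apply: gI => m m'.
by have [y <-] := pS m; have [y' <-] := pS m' => /gpI ->.
Qed.

Lemma minimal_element (F : cmodule C) (X : cobj C) (x : F X) : x <> 0 ->
  exists (M : cobj C) (f : {linear X -> M}),
    [/\ indecomposable M, cm_map F f x <> 0 &
      forall (Z : cobj C) (g : {linear M -> Z}), ~ split_mono g ->
        cm_map F g (cm_map F f x) = 0].
Proof.
move=> x0; apply: contrapT => nomin.
pose T := {M : cobj C & {linear X -> M}}.
pose P (s : T) := indecomposable (projT1 s) /\ strongly_minimal (cm_map F (projT2 s) x).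
have step (s : {s : T | P s}) : exists (t : {s : T | P s})
    (g : {linear projT1 (sval s) -> projT1 (sval t)}), injective g /\ ~ bijective g.
  case: s => -[M f] /= [iM [fx0 fxP]].
  have [Y [g [gn gx0]]] : exists (Y : cobj C) (g : {linear M -> Y}),
      ~ split_mono g /\ cm_map F g (cm_map F f x) <> 0.
    apply: contrapT => H; apply: nomin; exists M, f; split=> // Y g gn.
    by apply: contrapT => gx0; apply: H; exists Y, g.
  have [M' [h [iM' hP]]] := strongly_minimal_indecomposable gx0.
  have Pt : P (existT _ M' (h \o (g \o f) : {linear X -> M'})).
    by split=> //=; rewrite cm_map_comp cm_map_comp.
  (* Strong minimality of the image of x in M forces h g to be injective. Were it bijective, its
     inverse composed with h would split g. *)
  exists (exist _ _ Pt), (h \o g : {linear M -> M'}); split=> [|b].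
    apply: contrapT => hgI; case: hP => + _; apply.
    by rewrite -cm_map_comp; apply: fxP.
  have [r [rK _]] := lin_inv b; apply: gn.
  by exists (r \o h : {linear Y -> M}) => z; rewrite -[RHS]rK.
have /choice[next nextP] := step.
have [M0 [p0 P0]] := strongly_minimal_indecomposable x0.
pose s n := iter n next (exist P (existT _ M0 p0) P0).
pose f n := sval (cid (nextP (s n))).
have fP n : injective (f n) /\ ~ bijective (f n) := svalP (cid (nextP (s n))).
have iP n : indecomposable (projT1 (sval (s n))) by case: (svalP (s n)).
have [||n|d dP] := @noeth nat (fun n => Arrow (f n)) _ (fun n => projT1 (sval (s n))) f id.
- by move=> n; split; [exact: (iP n)|exact: (iP n.+1)|case: (fP n)].
- by [].
- have inj : injective (chain_comp f n.+1).
    by elim: n.+1 => [//|k IH] y z /=; move=> /(fP k).1/IH.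
  have [y y0] : exists y : M0, y <> 0.
    by apply/existsNP => M00; case: (iP 0%N) => + _; apply.
  by exists y => /(inj0 inj).
by case: (fP d) => _; apply; apply: dP.
Qed.

End Minimal.
End Functors.

(** * Morphism sets as modules over R *)

Section Hom.
Variables (R : comNzRingType) (L : algType R) (X Y : lmodType L).

Definition lhom := {linear X -> Y}.
HB.instance Definition _ := gen_eqMixin lhom.
HB.instance Definition _ := gen_choiceMixin lhom.

Implicit Types f g : lhom.

Lemma central_linear (r : R) : linear (fun y : Y => (r%:A : L) *: y).
Proof. by move=> a x y; rewrite scalerDr !scalerA mulr_algl mulr_algr. Qed.

Definition hom_zero : lhom := \0.
Definition hom_opp f : lhom := \- f.
Definition hom_add f g : lhom := f \+ g.
Definition hom_scale (r : R) f : lhom := lin_of (central_linear r) \o f.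

Lemma hom_addA : associative hom_add.
Proof. by move=> f g h; apply: linear_eqP => x /=; rewrite addrA. Qed.
Lemma hom_addC : commutative hom_add.
Proof. by move=> f g; apply: linear_eqP => x /=; rewrite addrC. Qed.
Lemma hom_add0 : left_id hom_zero hom_add.
Proof. by move=> f; apply: linear_eqP => x /=; rewrite add0r. Qed.
Lemma hom_addN : left_inverse hom_zero hom_opp hom_add.
Proof. by move=> f; apply: linear_eqP => x /=; rewrite addNr. Qed.

HB.instance Definition _ :=
  GRing.isZmodule.Build lhom hom_addA hom_addC hom_add0 hom_addN.

Lemma hom_scaleA (a b : R) f : hom_scale a (hom_scale b f) = hom_scale (a * b) f.
Proof. by apply: linear_eqP => x /=; rewrite scalerA mulr_algl scalerA. Qed.
Lemma hom_scale1 : left_id 1 hom_scale.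
Proof. by move=> f; apply: linear_eqP => x /=; rewrite !scale1r. Qed.
Lemma hom_scaleDr : right_distributive hom_scale +%R.
Proof. by move=> a f g; apply: linear_eqP => x /=; rewrite scalerDr. Qed.
Lemma hom_scaleDl f : {morph hom_scale^~ f : a b / a + b}.
Proof. by move=> a b; apply: linear_eqP => x /=; rewrite !scalerDl. Qed.

HB.instance Definition _ := GRing.Zmodule_isLmodule.Build R lhom
  hom_scaleA hom_scale1 hom_scaleDr hom_scaleDl.

End Hom.

(* Zorn's lemma for chains with least upper bounds, proved in its own universe:
   the library's Zorn is confined to a universe below that of the module types. *)
Section Zorn.
Variables (T : Type) (le : T -> T -> Prop).
Hypotheses (lexx : forall t, le t t)
  (le_trans : forall r s t, le r s -> le s t -> le r t)
  (le_anti : forall s t, le s t -> le t s -> s = t).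

Definition lub (F : T -> Prop) u :=
  (forall s, F s -> le s u) /\ forall v, (forall s, F s -> le s v) -> le u v.

(** The Bourbaki-Witt tower; it starts at the least upper bound of the empty family. *)
Inductive tower (g : T -> T) : T -> Prop :=
| tower_next t : tower g t -> tower g (g t)
| tower_lub (F : T -> Prop) u : (forall s, F s -> tower g s) -> lub F u -> tower g u.

Lemma zorn_lub :
  (forall F : T -> Prop, (forall s t, F s -> F t -> le s t \/ le t s) -> exists u, lub F u) ->
  exists t, forall s, le t s -> s = t.
Proof.
move=> lubP; apply: contrapT => nomax.
have /choice[g gP] (t : T) : exists s, le t s /\ s <> t.
  apply: contrapT => H; apply: nomax; exists t => s ts.
  by apply: contrapT => st; apply: H; exists s.
(* The successor of a tower element strictly below c does not jump over c. Once this holds for every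
   c in the tower, the tower is a chain, and its least upper bound is fixed by g. *)
pose extreme c := forall x, tower g x -> le x c -> x <> c -> le (g x) c.
have comparable c : extreme c -> forall x, tower g x -> le x c \/ le (g c) x.
  move=> ec x; elim=> {x} [x Wx [xc|cx]|F u FW IH [uF uleast]].
  - have [->|nxc] := pselect (x = c); first by right.
    by left; apply: ec.
  - by right; apply: le_trans cx (gP x).1.
  have [H|/existsNP[s /not_implyP[Fs nsc]]] := pselect (forall s, F s -> le s c).
    by left; apply: uleast.
  by right; case: (IH s Fs) => // cs; apply: le_trans cs (uF s Fs).
have all_extreme c : tower g c -> extreme c.
  elim=> {c} [c Wc ec|F u FW IH [uF uleast]] x Wx xc nxc.
    case: (comparable c ec x Wx) => [xc'|cx]; last by case: nxc; apply: le_anti.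
    have [->//|nxc'] := pselect (x = c).
    exact: le_trans (ec x Wx xc' nxc') (gP c).1.
  have [s Fs nsx] : exists2 s, F s & ~ le (g s) x.
    apply: contrapT => H; apply: nxc; apply: le_anti => //; apply: uleast => s Fs.
    apply: le_trans (gP s).1 _; apply: contrapT => H'; apply: H; by exists s.
  have es := IH s Fs; case: (comparable s es x Wx) => // xs.
  have [E|nxs] := pselect (x = s); last exact: le_trans (es x Wx xs nxs) (uF s Fs).
  have Wu : tower g u by apply: (tower_lub FW).
  case: (comparable s es u Wu) => [us|]; last by rewrite E.
  by case: nxc; apply: le_anti; rewrite // E.
have [U UP] : exists u, lub (tower g) u.
  apply: lubP => s t Ws Wt; case: (comparable t (all_extreme t Wt) s Ws); first by left.
  by right; apply: le_trans (gP t).1 _.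
have WU : tower g U by apply: tower_lub UP.
have [_] := gP U; apply; apply: le_anti (gP U).1.
by apply: UP.1; apply: tower_next.
Qed.

End Zorn.

(** * Subfunctors of Hom(X, -) and the finiteness of its support *)

Section Subfunctors.
Variables (R : comNzRingType) (L : algType R) (C : lmodType L -> Prop).
Variable X : cobj C.

Definition postcomp (Y Z : cobj C) (g : {linear Y -> Z}) (x : lhom X Y) : lhom X Z :=
  (g \o x : {linear X -> Z}).
Arguments postcomp Y Z g x /.

Definition subfunctor (K : forall Y : cobj C, set (lhom X Y)) :=
  (forall Y, is_submodule (K Y)) /\
  (forall (Y Z : cobj C) (g : {linear Y -> Z}) (x : lhom X Y), K Y x -> K Z (postcomp g x)).

Lemma postcomp_linear (Y Z : cobj C) (g : {linear Y -> Z}) :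
  linear ((fun x => (postcomp g x)) : lhom X Y -> lhom X Z).
Proof. by move=> r x y; apply: linear_eqP => z /=; rewrite linearD (linZ g). Qed.

Lemma quotient_functor K : subfunctor K ->
  exists (F : cmodule C) (p : forall Y : cobj C, lhom X Y -> F Y),
    (forall Y x, p Y x = 0 <-> K Y x) /\
    (forall (Y Z : cobj C) (g : {linear Y -> Z}) x, cm_map F g (p Y x) = p Z (postcomp g x)).
Proof.
move=> [hK KZ].
pose Q Y := sval (cid (quotient_exists (hK Y))).
pose cp Y := cid (svalP (cid (quotient_exists (hK Y)))).
pose p (Y : cobj C) : {linear lhom X Y -> Q Y} := sval (cp Y).
have pS (Y : cobj C) : forall y, exists x, p Y x = y := (svalP (cp Y)).1.
have pk (Y : cobj C) : forall x, p Y x = 0 <-> K Y x := (svalP (cp Y)).2.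
have ex (Y Z : cobj C) (g : {linear Y -> Z}) : exists m : {linear Q Y -> Q Z},
    forall x, m (p Y x) = p Z (postcomp g x).
  have [x /pk Kx|m mP] := lin_factor (p := p Y) (f := p Z \o lin_of (postcomp_linear g)) (pS Y).
    by apply/pk/KZ.
  by exists m => x; rewrite mP.
pose m (Y Z : cobj C) (g : {linear Y -> Z}) : {linear Q Y -> Q Z} := sval (cid (ex Y Z g)).
have mP (Y Z : cobj C) (g : {linear Y -> Z}) x : m Y Z g (p Y x) = p Z (postcomp g x) := svalP (cid (ex Y Z g)) x.
have m_id (Y : cobj C) (x : Q Y) : m Y Y (idfun : {linear Y -> Y}) x = x.
  by have [y <-] := pS Y x; rewrite mP; congr (p Y _); apply: linear_eqP.
have m_comp (Y Z W : cobj C) (g : {linear Z -> W}) (f : {linear Y -> Z}) (x : Q Y) :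
    m Y W (g \o f : {linear Y -> W}) x = m Z W g (m Y Z f x).
  by have [y <-] := pS Y x; rewrite !mP; congr (p W _); apply: linear_eqP.
have m_add (Y Z : cobj C) (f g : {linear Y -> Z}) (x : Q Y) :
    m Y Z (f \+ g : {linear Y -> Z}) x = m Y Z f x + m Y Z g x.
  by have [y <-] := pS Y x; rewrite !mP -linearD; congr (p Z _); apply: linear_eqP.
exists (CModule (cm_map := fun Y Z g => m Y Z g : {additive Q Y -> Q Z}) m_id m_comp m_add).
by exists p.
Qed.

(* A subfunctor K of Hom(X, -) such that K is finitely generated (hence cyclic,
   C being additive) and Hom(X, -)/K has finite support. *)
Definition cofinite (K : forall Y : cobj C, set (lhom X Y)) :=
  (exists (Y : cobj C) (k : lhom X Y), K Y k /\
     forall Z z, K Z z -> exists h : {linear Y -> Z}, forall x, z x = h (k x)) /\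
  (exists (n : nat) (s : 'I_n -> lmodType L), forall M : cobj C, indecomposable M ->
     (exists z : lhom X M, ~ K M z) -> exists i, isomorphic M (s i)).

Hypothesis prodC : forall Y Z, C Y -> C Z -> C (Y * Z)%type.
Hypothesis almost_split : forall M : cobj C, indecomposable M ->
  exists (E : cobj C) (u : {linear M -> E}), ~ split_mono u /\
    forall (Z : cobj C) (h : {linear M -> Z}), ~ split_mono h ->
      exists h' : {linear E -> Z}, forall x, h x = h' (u x).

Lemma split_mono_iso (Y Z : lmodType L) (u : {linear Y -> Z}) :
  indecomposable Z -> (exists y : Y, y <> 0) -> split_mono u -> isomorphic Z Y.
Proof.
move=> iZ [y y0] [v uK].
have [x Ux Vx||U0|V0] := indecomposable_split iZ (submod_image u (submodT Y)) (submod_ker v).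
- by case: Ux Vx => z _ <-; rewrite /ker /= uK => ->; rewrite linear0.
- move=> x; exists (u (v x)), (x - u (v x)); split; first by exists (v x).
    by rewrite /ker /= linearB uK subrr.
  by rewrite addrC subrK.
- by exfalso; apply: y0; rewrite -(uK y) (U0 (u y)) ?linear0 //; exists y.
exists v; apply: bij_of; first exact: inj_ker.
by move=> z; exists (u z).
Qed.

(** Let y = k + g x generate the enlarged functor. If z = h y lies in K, then h g sends x into K, so
    it is not a split monomorphism and factors through the left almost split map u. Hence k and u x
    together generate K. The support grows at most by M. *)
Lemma cofinite_step K (M : cobj C) (x : lhom X M) : subfunctor K -> indecomposable M ->
  ~ K M x -> (forall (Z : cobj C) (g : {linear M -> Z}), ~ split_mono g ->
    K Z (postcomp g x)) ->
  cofinite (fun Z => [set z | exists k (g : {linear M -> Z}), K Z k /\ z = k + (postcomp g x) :> lhom X Z]) ->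
  cofinite K.
Proof.
move=> [hK KZ] iM Kx xmin [[Y [y [[k [g [Kk yE]]] ygen]]] [n [s sP]]].
split.
  have [E [u [un uP]]] := almost_split iM.
  pose YE := CObj (prodC (cobjP Y) (cobjP E)).
  pose ux := postcomp u x.
  pose w : lhom X YE := lin_of (pair_linear (k : {linear X -> Y}) ux).
  exists YE, w; split=> [|Z z Kz].
    pose i1 : {linear Y -> YE} := lin_of (pair_linear idfun (\0 : {linear Y -> E})).
    pose i2 : {linear E -> YE} := lin_of (pair_linear (\0 : {linear E -> Y}) idfun).
    rewrite (_ : w = (postcomp i1 k) + (postcomp i2 ux) :> lhom X YE).
      by apply: submodD => //; apply: KZ => //; apply: xmin.
    by apply: linear_eqP => t /=; congr (_, _); rewrite /= ?addr0 ?add0r.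
  have [|h hP] := ygen Z z.
    by exists z, \0; split=> //; apply: linear_eqP => t /=; rewrite addr0.
  have yt t : y t = k t + g (x t) by rewrite yE.
  have Khgx : K Z (postcomp (h \o g : {linear M -> Z}) x).
    rewrite (_ : postcomp _ x = z - postcomp h k).
      by apply: submodB => //; apply: KZ.
    by apply: linear_eqP => t /=; rewrite hP yt linearD addrAC subrr add0r.
  have [|h' h'P] := uP Z (h \o g : {linear M -> Z}).
    move=> [r rK]; apply: Kx.
    rewrite (_ : x = (postcomp r (postcomp (h \o g : {linear M -> Z}) x)) :> lhom X M).
      exact: KZ.
    by apply: linear_eqP => t; rewrite /= -[LHS]rK.
  have hl : linear (fun v : (Y * E)%type => h v.1 + h' v.2).
    by move=> a [v1 v2] [w1 w2] /=; rewrite !linearP scalerDr addrACA.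
  by exists (lin_of hl) => t; rewrite hP yt linearD /= -h'P.
exists n.+1, (fun i => if unlift ord0 i is Some j then s j else M) => Z iZ [z Kz].
have [[k' [g' [Kk' zE]]]|K'z] := pselect (exists k (g : {linear M -> Z}),
    K Z k /\ z = k + (postcomp g x) :> lhom X Z); last first.
  have [|i iP] := sP Z iZ; first by exists z.
  by exists (lift ord0 i); rewrite liftK.
exists ord0; rewrite unlift_none; apply: (split_mono_iso (u := g') iZ).
  by apply/existsNP => M0; case: iM.
apply: contrapT => /xmin Kgx; apply: Kz; rewrite zE; exact: submodD.
Qed.

Hypothesis min_elt : forall (F : cmodule C) (Y : cobj C) (y : F Y), y <> 0 ->
  exists (M : cobj C) (f : {linear Y -> M}),
    [/\ indecomposable M, cm_map F f y <> 0 &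
      forall (Z : cobj C) (g : {linear M -> Z}), ~ split_mono g ->
        cm_map F g (cm_map F f y) = 0].

Lemma zero_cofinite : cofinite (fun Y => [set 0]).
Proof.
apply: contrapT => bad0.
pose bad K := subfunctor K /\ ~ cofinite K.
have badP0 : bad (fun Y => [set 0]).
  split=> //; split=> [Y|Y Z g x ->]; first exact: submod_set0.
  by apply: linear_eqP => t; rewrite /= linear0.
pose T := {K | bad K}.
pose r (s t : T) := forall Y, sval s Y `<=` sval t Y.
have [s|s t v st tv|[s ps] [t pt] /= st ts|F Ftot|[K [sK nK]] maxK] := @zorn_lub T r.
- by move=> Y.
- by move=> Y; apply: subset_trans (tv Y).
- by apply: eq_exist; apply: functional_extensionality_dep => Y; apply/seteqP.
- have [[t0 Ft0]|F0] := pselect (exists t, F t); last first.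
    exists (exist _ _ badP0); split=> [s Fs|[v [[sv vK] nv]] _ Y _ ->].
      by exfalso; apply: F0; exists s.
    exact: submod0.
  pose U (Y : cobj C) : set (lhom X Y) := [set x | exists2 t, F t & sval t Y x].
  have sU : subfunctor U.
    split=> [Y|Y Z g x [t Ft tx]]; last by exists t => //; apply: (svalP t).1.2.
    split; first by exists t0 => //; apply: submod0; apply: (svalP t0).1.1.
    move=> a x y [s Fs sx] [t Ft ty]; case: (Ftot s t Fs Ft) => H.
      by exists t => //; apply: ((svalP t).1.1 Y).2 => //; apply: H.
    by exists s => //; apply: ((svalP s).1.1 Y).2 => //; apply: H.
  (* A generator of the union lies in some member of the chain; that member is then the whole union
     and would be cofinite. *)
  have nU : ~ cofinite U.
    move=> cU; have [[Y [k [[t Ft tk] kgen]]] _] := cU.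
    apply: (svalP t).2; rewrite (_ : sval t = U) //.
    apply: functional_extensionality_dep => Z; apply/seteqP; split=> z; first by exists t.
    move=> /kgen[h hP]; rewrite (_ : z = postcomp h k); last exact: linear_eqP.
    exact: (svalP t).1.2.
  exists (exist _ U (conj sU nU)); split=> [s Fs Y x sx|v vP Y x [s Fs]]; first by exists s.
  exact: vP.
(* All of Hom(X, -) is cofinite, being generated by the identity with zero quotient, so K is
   proper. *)
have [[Y [y Ky]]|full] := pselect (exists (Y : cobj C) (y : lhom X Y), ~ K Y y); last first.
  apply: (nK); split.
    exists X, (idfun : {linear X -> X}); split=> [|Z z _]; last by exists z.
    by apply: contrapT => H; apply: full; exists X, idfun.
  exists 0%N, (fun _ => L^o) => M _ [z Kz]; exfalso; apply: full; by exists M, z.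
have [F [p [pk pg]]] := quotient_functor sK.
have [|M [f [iM fy0 fymin]]] := min_elt (F := F) (y := p Y y); first by move/pk.
rewrite pg in fy0 fymin.
pose x : lhom X M := postcomp f y.
have Kx : ~ K M x by move/pk.
have xmin (Z : cobj C) (g : {linear M -> Z}) : ~ split_mono g -> K Z (postcomp g x).
  by move=> /fymin; rewrite pg => /pk.
(* K plus the subfunctor generated by x. It is strictly larger than K, so maximality makes it
   cofinite. *)
pose K' (Z : cobj C) : set (lhom X Z) := [set z | exists k (g : {linear M -> Z}),
  K Z k /\ z = k + (postcomp g x) :> lhom X Z].
have KK' Z : K Z `<=` K' Z.
  move=> z Kz; exists z, \0; split=> //.
  by apply: linear_eqP => t /=; rewrite addr0.
have K'x : K' M x.
  exists 0, idfun; split; first exact: submod0 (sK.1 M).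
  by apply: linear_eqP => t /=; rewrite add0r.
have sK' : subfunctor K'.
  split=> [Z|Z W h _ [k [g [Kk ->]]]].
    split; first by apply: KK'; exact: submod0 (sK.1 Z).
    move=> a _ _ [k [g [Kk ->]]] [k1 [g1 [Kk1 ->]]].
    exists (a *: k + k1), ((lin_of (central_linear (Y := Z) a) \o g) \+ g1).
    split; first exact: (sK.1 Z).2.
    by apply: linear_eqP => t /=; rewrite scalerDr addrACA.
  exists (postcomp h k), (h \o g : {linear M -> W}); split; first exact: sK.2.
  by apply: linear_eqP => t /=; rewrite linearD.
have cK' : cofinite K'.
  apply: contrapT => nK'.
  have /(congr1 sval)/= E := maxK (exist _ K' (conj sK' nK')) KK'.
  by apply: Kx; rewrite -E.
by apply: (nK); apply: cofinite_step cK'.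
Qed.

End Subfunctors.

(** * Finite representation type and the two conditions *)

Theorem theoremC (R : comNzRingType) (L : algType R) (C : lmodType L -> Prop) :
  artin_algebra L ->
  in_mod C -> additive_subcategory C -> summand_closed C -> iso_closed C ->
  functorially_finite C ->
  C (L^o : lmodType L) \/ contains_dual_regular C ->
  finite_representation_type C <->
  ((forall (F : cmodule C) (X : cobj C) (x : F X), x <> 0 ->
      exists (X' : cobj C) (f : {linear X -> X'}),
        strongly_minimal (cm_map F f x)) /\
   (forall (J : Type) (phi : J -> arrow C),
      (forall j, [/\ indecomposable (arrow_src (phi j)),
                     indecomposable (arrow_tgt (phi j))
                   & injective (phi j)]) ->
      noetherian_family phi)).
Proof.
move=> artL fgC [_ prodC] sumC _ ffC _.
have finC X : C X -> finite X by move=> /fgC/(finite_fg artL).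
split=> [ft|[sm noeth]].
  split; first exact: finite_type_strongly_minimal.
  exact: finite_type_noetherian.
have almost_split (M : cobj C) : indecomposable M ->
    exists (E : cobj C) (u : {linear M -> E}), ~ split_mono u /\
      forall (Z : cobj C) (h : {linear M -> Z}), ~ split_mono h ->
        exists h' : {linear E -> Z}, forall x, h x = h' (u x).
  move=> iM.
  (* A left almost split map in mod L, followed by a left approximation of its target, is left
     almost split in the subcategory. *)
  have [Y [u [fgY un uP]]] := left_almost_split artL (fgC _ (cobjP M)) iM.
  have [[E [v [CE vP]]] _] := ffC Y fgY.
  exists (CObj CE), (v \o u : {linear M -> E}); split=> [[r rK]|Z h hn].
    by apply: un; exists (r \o v : {linear Y -> M}).
  have [h1 h1P] := uP Z h (fgC _ (cobjP Z)) hn.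
  have [h2 h2P] := vP Z (cobjP Z) h1.
  by exists h2 => x; rewrite h1P h2P.
have [[X [u [CX uP]]] _] := ffC _ (fg_regular L).
have [_ [n [s sP]]] := zero_cofinite (CObj CX) prodC almost_split
  (minimal_element finC sumC sm noeth).
exists n, s => M CM iM; apply: (sP (CObj CM) iM).
have [m m0] : exists m : M, m <> 0 by apply/existsNP => M0; case: iM.
(* The map from L to M with 1 sent to m factors through X, so Hom(X, M) is nonzero and M lies in the
   finite support. *)
have [z zP] := uP M CM (lin_of (scaler_linear m)).
exists z => z0; apply: m0.
by rewrite -[m]scale1r -[LHS]/(lin_of (scaler_linear m) 1) zP z0.
Qed.
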